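(* Let $t_f>0$, $n\ge1$, $\mathcal T=n+1$, let $\mathbf p=\{v_0,v_1,\dots,v_{\mathcal T-1},v_{\mathcal T}\}$ be a line graph with edge weights $w(v_{\ell-1},v_\ell)>0$, let $\mu^0,\mu^{\mathcal T}$ be probability measures on $[0,t_f]$, and let $r_1,\dots,r_{\mathcal T-1}>0$. Consider the problem of minimizing $$\int c^{(\mathbf p)}(t_0,t_1,\dots,t_{\mathcal T})\,\pi(dt_0,dt_1,\dots,dt_{\mathcal T}),\qquad c^{(\mathbf p)}(t_0,\dots,t_{\mathcal T})=\sum_{\ell=1}^{\mathcal T}\frac{w(v_{\ell-1},v_\ell)}{t_\ell-t_{\ell-1}},$$ over all $\pi\in\mathcal M_+([0,t_f]^{n+2})$ whose $t_0$-marginal is $\mu^0$, whose $t_{\mathcal T}$-marginal is $\mu^{\mathcal T}$, and whose $t_\ell$-marginal is bounded above by $r_\ell\,dt_\ell$ for each $\ell=1,\dots,\mathcal T-1$. If this problem is feasible, then it admits a unique minimizer.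
   Context: $\mathcal M_+([0,t_f]^{n+2})$ is the set of nonnegative measures on $[0,t_f]^{n+2}$ with coordinates $(t_0,\dots,t_{\mathcal T})$ ($t_\ell$ is the time at which mass passes node $v_\ell$). The cost is given by the formula for $t_0<t_1<\dots<t_{\mathcal T}$ and is $+\infty$ otherwise. Feasible means that there is a measure satisfying all the constraints with finite cost. *)

(* Defs.v *)
From HB Require Import structures.
From mathcomp Require Import all_boot all_order all_algebra.
From mathcomp Require Import all_classical all_reals all_analysis.

Set Implicit Arguments.
Unset Strict Implicit.
Unset Printing Implicit Defensive.

Import Order.TTheory GRing.Theory Num.Theory.
Import numFieldNormedType.Exports.

Local Open Scope classical_set_scope.
Local Open Scope ring_scope.

(* The node v_l is identified with its index l : 'I_n.+2, so that the last
   node has index n.+1.  The edges are indexed by e : 'I_n.+1, the edge e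
   joining v_e to v_(e+1). *)
Definition edge_src (n : nat) (e : 'I_n.+1) : 'I_n.+2 :=
  widen_ord (leqnSn n.+1) e.

Definition edge_dst (n : nat) (e : 'I_n.+1) : 'I_n.+2 := lift ord0 e.

(* Passage times t = (t_0, ..., t_(n+1)), with the product of the Borel
   sigma-algebras. *)
Notation times R n := ((n.+2).-tuple (measurableTypeR R)).

Definition time (R : realType) (n : nat) (l : 'I_n.+2) (t : times R n) : R := tnth t l.

Definition path_cost (R : realType) (n : nat) (w : 'I_n.+2 -> 'I_n.+2 -> R)
    (t : times R n) : \bar R :=
  if [forall e : 'I_n.+1,
        time (edge_src e) t < time (edge_dst e) t]
  then (\sum_(e < n.+1) w (edge_src e) (edge_dst e)
          / (time (edge_dst e) t - time (edge_src e) t))%:E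
  else +oo%E.

Definition time_cube (R : realType) (n : nat) (tf : R) : set (times R n) :=
  [set t | forall l : 'I_n.+2, 0 <= time l t <= tf].

(* A measure on [0,tf]^(n+2) is encoded as a measure on R^(n+2) for which the
   complement of the cube is null. *)
Definition on_cube (R : realType) (n : nat) (tf : R)
    (pi : {measure set (times R n) -> \bar R}) : Prop :=
  pi (~` time_cube tf) = 0%E.

Definition marginal (R : realType) (n : nat)
    (pi : {measure set (times R n) -> \bar R}) (l : 'I_n.+2) :
    set (measurableTypeR R) -> \bar R :=
  pushforward pi (time l : times R n -> measurableTypeR R).

Definition transport_plan (R : realType) (n : nat) (tf : R)
    (mu0 muT : probability (measurableTypeR R) R) (r : 'I_n.+2 -> R)
    (pi : {measure set (times R n) -> \bar R}) : Prop :=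
  [/\ on_cube tf pi,
      forall A : set (measurableTypeR R), measurable A ->
        marginal pi ord0 A = mu0 A,
      forall A : set (measurableTypeR R), measurable A ->
        marginal pi ord_max A = muT A
    & forall l : 'I_n.+2, (0 < l < n.+1)%N ->
        forall A : set (measurableTypeR R), measurable A ->
          (marginal pi l A <= (r l)%:E * lebesgue_measure A)%E].

Definition total_cost (R : realType) (n : nat) (w : 'I_n.+2 -> 'I_n.+2 -> R)
    (pi : {measure set (times R n) -> \bar R}) : \bar R :=
  (\int[pi]_t path_cost w t)%E.

Definition feasible (R : realType) (n : nat) (tf : R)
    (w : 'I_n.+2 -> 'I_n.+2 -> R)
    (mu0 muT : probability (measurableTypeR R) R) (r : 'I_n.+2 -> R) : Prop :=
  exists2 pi : {measure set (times R n) -> \bar R},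
    transport_plan tf mu0 muT r pi & (total_cost w pi < +oo)%E.

Definition minimizer (R : realType) (n : nat) (tf : R)
    (w : 'I_n.+2 -> 'I_n.+2 -> R)
    (mu0 muT : probability (measurableTypeR R) R) (r : 'I_n.+2 -> R)
    (pi : {measure set (times R n) -> \bar R}) : Prop :=
  transport_plan tf mu0 muT r pi /\
  forall pi' : {measure set (times R n) -> \bar R},
    transport_plan tf mu0 muT r pi' -> (total_cost w pi <= total_cost w pi')%E.

(* Main.v *)
(* Optimality forces every consecutive pair of coordinates to be coupled
   monotonically, so a plan may be replaced by the curve
   u |-> (Q_0 u, ..., Q_(n+1) u) of the quantile functions of its marginals,
   u uniform on [0, 1].  In terms of quantile functions the density bound
   mu_l <= r_l dt reads v - u <= r_l (Q_l v - Q_l u) for u < v, a convex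
   constraint, and the cost is the integral of sum_l w_l / (Q_l - Q_(l-1)),
   which is uniformly convex in the gaps because these are at most tf.  Hence
   minimizing sequences of curves are Cauchy, Fatou's lemma gives a minimizing
   curve, and this curve is unique up to null sets.

   The monotone rearrangement inequality comes from the identity
     1/(y - x) = int_(a > 0) 2/a^3 int_z 1_(z < x) 1_(y <= z + a) dz da,
   which turns the pair cost of a coupling into a mixture of the probabilities
   P(z < X, Y <= w); each of them is smallest for the monotone coupling, and
   equality of the costs forces equality of all these probabilities.  As the
   marginal at node 1 has no atom, V = F_1(t_1) is uniform, and an optimal plan
   is the law of the quantile curve at V. *)

Require Import Defs.
From HB Require Import structures.
From mathcomp Require Import all_boot all_order all_algebra.
From mathcomp Require Import all_classical all_reals all_analysis.
From mathcomp Require Import measurable_realfun ring lra.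

Set Implicit Arguments.
Unset Strict Implicit.
Unset Printing Implicit Defensive.

Import Order.TTheory GRing.Theory Num.Theory.
Import numFieldNormedType.Exports.

Local Open Scope classical_set_scope.
Local Open Scope ring_scope.

(** * Quantile functions *)

Section quantile.
Context {R : realType}.
Implicit Types (F : R -> R) (u z tf : R).

(** The last clause is right-continuity of a nondecreasing function, in the form which shows that
    the infimum defining a quantile is attained. The value at 0 may be positive, so an atom at 0 is
    allowed. *)
Definition is_cdf tf F :=
  [/\ {homo F : x y / x <= y},
      forall z, z < 0 -> F z = 0,
      forall z, tf <= z -> F z = 1
    & forall z u, (forall z', z < z' -> u <= F z') -> u <= F z].

(* The cap at 1 and the condition [0 <= z] keep the value in [0, tf] for every
   real u; only u in ]0, 1] matters. *)
Definition quantile F u : R := inf [set z | 0 <= z /\ Num.min u 1 <= F z].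

Lemma is_cdf_ge0 tf F z : is_cdf tf F -> 0 <= F z.
Proof.
move=> [ndF F0 _ _].
have -> : 0 = F (Num.min z (-1)) by rewrite F0// gt_min ltrN10 orbT.
by apply: ndF; rewrite ge_min lexx.
Qed.

Lemma is_cdf_le1 tf F z : is_cdf tf F -> F z <= 1.
Proof.
move=> [ndF _ F1 _]; have -> : 1 = F (Num.max z tf) by rewrite F1// le_max lexx orbT.
by apply: ndF; rewrite le_max lexx.
Qed.

Let quantile_lbound F u : lbound [set z | 0 <= z /\ Num.min u 1 <= F z] 0.
Proof. by move=> z []. Qed.

Lemma quantile_bounds tf F u : 0 < tf -> is_cdf tf F -> 0 <= quantile F u <= tf.
Proof.
move=> tf0 [ndF F0 F1 rcF].
have tfin : [set z | 0 <= z /\ Num.min u 1 <= F z] tf.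
  by split; [exact: ltW|rewrite F1// ge_min lexx orbT].
apply/andP; split.
  by apply: lb_le_inf => //; exists tf.
by apply: ge_inf => //; exists 0; exact: quantile_lbound.
Qed.

Lemma quantile_nd tf F : 0 < tf -> is_cdf tf F ->
  {homo quantile F : u v / u <= v}.
Proof.
move=> tf0 [ndF F0 F1 rcF] u v uv.
have tfin : [set z | 0 <= z /\ Num.min v 1 <= F z] tf.
  by split; [exact: ltW|rewrite F1// ge_min lexx orbT].
apply: lb_le_inf; first by exists tf.
move=> z [z0 vz]; apply: ge_inf; first by exists 0; exact: quantile_lbound.
split => //; apply: le_trans vz.
by rewrite le_min !ge_min uv lexx orbT.
Qed.

Lemma measurable_quantile tf F : 0 < tf -> is_cdf tf F ->
  measurable_fun setT (quantile F : measurableTypeR R -> measurableTypeR R).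
Proof.
by move=> tf0 cF; apply: nondecreasing_measurable => //; exact: quantile_nd cF.
Qed.

(** The Galois connection between [F] and its quantile function: right-continuity makes the infimum
    attained, and [0 < u] rules out negative [z], where [F] vanishes. *)
Lemma quantile_le tf F u z : 0 < tf -> is_cdf tf F -> 0 < u <= 1 ->
  (quantile F u <= z) = (u <= F z).
Proof.
move=> tf0 cF /andP[u0 u1]; have [ndF F0 F1 rcF] := cF.
have min_u : Num.min u 1 = u by apply/min_idPl.
apply/idP/idP => [Quz|uFz]; last first.
  apply: ge_inf; first by exists 0; exact: quantile_lbound.
  rewrite /= min_u; split => //; rewrite leNgt; apply/negP => z0.
  by move: uFz; rewrite F0// leNgt u0.
apply: rcF => z' zz'.
have zz'0 : 0 < z' - quantile F u by rewrite subr_gt0; exact: le_lt_trans zz'.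
have hi : has_inf [set z | 0 <= z /\ Num.min u 1 <= F z].
  split; last by exists 0; exact: quantile_lbound.
  by exists tf; split; [exact: ltW|rewrite F1// ge_min lexx orbT].
have [y [y0 uFy]] := inf_adherent zz'0 hi.
rewrite addrC subrK => yz'; rewrite min_u in uFy.
by apply: (le_trans uFy); apply: ndF; exact: ltW.
Qed.

(** [F] is at least [v] at [quantile F v] and below [u] everywhere to the left of [quantile F u],
    while its slope is at most [r]. *)
Lemma quantile_expand tf F r u v : 0 < tf -> is_cdf tf F -> 0 < r ->
  (forall a b, a <= b -> F b - F a <= r * (b - a)) ->
  0 < u -> u < v -> v <= 1 -> v - u <= r * (quantile F v - quantile F u).
Proof.
move=> tf0 cF r0 lipF u0 uv v1.
have u1 : u <= 1 by rewrite ltW// (lt_le_trans uv).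
have v0 : 0 < v by exact: lt_trans uv.
have vF : v <= F (quantile F v) by rewrite -(quantile_le _ tf0 cF) ?v0.
have Qnd : quantile F u <= quantile F v by apply: (quantile_nd tf0 cF); exact: ltW.
apply/ler_addgt0Pr => e e0.
(* The point lies [e / r] to the left of the quantile, so that the Lipschitz bound loses exactly
   [e]. *)
have Fu : F (quantile F u - e / r) < u.
  by rewrite ltNge -(quantile_le _ tf0 cF) ?u0// -ltNge ltrBlDr ltrDl divr_gt0.
have er0 : 0 < e / r by rewrite divr_gt0.
have := lipF (quantile F u - e / r) (quantile F v) ltac:(lra).
have -> : r * (quantile F v - (quantile F u - e / r)) =
    r * (quantile F v - quantile F u) + e by field; rewrite gt_eqF.
lra.
Qed.

End quantile.

(** * Distribution functions of random variables *)

Section distribution_function.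
Context {R : realType} d (T : measurableType d) (P : probability T R).
Variable X : T -> measurableTypeR R.
Hypothesis mX : measurable_fun setT X.

Lemma measurable_le_fun (z : R) : measurable [set t | X t <= z].
Proof.
have -> : [set t | X t <= z] = setT `&` X @^-1` `]-oo, z].
  by apply/seteqP; split => t /=; rewrite in_itv/= ?setTI //; case.
exact: mX.
Qed.

Lemma measurable_gt_fun (z : R) : measurable [set t | z < X t].
Proof.
have -> : [set t | z < X t] = ~` [set t | X t <= z].
  by apply/seteqP; split => t /=; rewrite ltNge => /negP.
exact/measurableC/measurable_le_fun.
Qed.

Definition dist_fun (z : R) : R := fine (P [set t | X t <= z]).

Lemma dist_funE z : (dist_fun z)%:E = P [set t | X t <= z].
Proof. by rewrite fineK// fin_num_measure//; exact: measurable_le_fun. Qed.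

Lemma is_cdf_dist_fun tf : P [set t | ~~ (0 <= X t <= tf)] = 0%E ->
  is_cdf tf dist_fun.
Proof.
move=> PX.
have mN : measurable [set t | ~~ (0 <= X t <= tf)].
  have -> : [set t | ~~ (0 <= X t <= tf)] = setT `&` X @^-1` (~` `[0, tf]).
    rewrite setTI; apply/seteqP; split => t /=; rewrite in_itv/=.
      by move/negP.
    by move/negP.
  exact/mX/measurableC.
have PN z : measurable [set t | X t <= z] by exact: measurable_le_fun.
split.
- move=> x y xy; rewrite -lee_fin !dist_funE; apply: le_measure; rewrite ?inE//.
  by move=> t /= /le_trans; exact.
- move=> z z0; apply: EFin_inj; rewrite dist_funE.
  apply: (subset_measure0 (B := [set t | ~~ (0 <= X t <= tf)])) => //.
  by move=> t /= Xz; apply/negP => /andP[]; rewrite leNgt (le_lt_trans Xz).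
- move=> z tfz; apply: EFin_inj; rewrite dist_funE.
  have <- : P (~` [set t | ~~ (0 <= X t <= tf)]) = 1%E.
    by rewrite probability_setC// PX sube0.
  apply/eqP; rewrite eq_le; apply/andP; split.
    by rewrite probability_setC// PX sube0 probability_le1.
  apply: le_measure; rewrite ?inE//; first exact: measurableC.
  by move=> t /= /negP /negPn /andP[_ /le_trans]; exact.
- move=> z u uF; rewrite -lee_fin dist_funE.
  (* Right-continuity is continuity of [P] from above along thresholds decreasing to [z]. *)
  have -> : [set t | X t <= z] = \bigcap_n [set t | X t <= z + n.+1%:R^-1].
    apply/seteqP; split => [t /= Xz n _|t /= H]; first by rewrite /= ler_wpDr.
    rewrite leNgt; apply/negP => /ltr_add_invr[k]; rewrite ltNge => /negP; apply.
    exact: H.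
  have cvgP : P [set t | X t <= z + n.+1%:R^-1] @[n --> \oo] -->
      P (\bigcap_n [set t | X t <= z + n.+1%:R^-1]).
    apply: nonincreasing_cvg_mu => //.
    - by rewrite (le_lt_trans (probability_le1 _ _)) ?ltry.
    - exact: bigcap_measurable.
    - move=> n m nm; apply/subsetPset => t /= /le_trans; apply.
      by rewrite lerD2l lef_pV2 ?posrE// ler_nat.
  rewrite -(cvg_lim _ cvgP)//; apply: lime_ge; first by apply/cvg_ex; eexists; exact: cvgP.
  apply: nearW => n; rewrite -dist_funE lee_fin; apply: uF.
  by rewrite ltrDl.
Qed.
End distribution_function.

(** * The uniform law on [0, 1] *)

Section uniform.
Context {R : realType}.

Definition unif := (uniform_prob (@ltr01 R) : probability _ R).

Lemma unifE (A : set (measurableTypeR R)) : measurable A ->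
  unif A = lebesgue_measure (A `&` `[0, 1]).
Proof.
move=> mA; rewrite /unif /= /uniform_prob integral_uniform_pdf.
rewrite (eq_integral (cst 1%E)).
  by rewrite integral_cst ?mul1e//; exact: measurableI.
move=> x; rewrite inE => -[_]; rewrite /= in_itv/= /uniform_pdf => ->.
by rewrite subr0 invr1.
Qed.

Lemma unif_itv (a b : R) : 0 <= a -> a <= b -> b <= 1 ->
  unif `]a, b]%classic = (b - a)%:E.
Proof.
move=> a0 ab b1; rewrite unifE// setIidl.
  rewrite lebesgue_measure_itv/= lte_fin; case: ltgtP ab => // -> _.
  by rewrite subrr.
by move=> x /=; rewrite !in_itv/= => /andP[/ltW ? ?]; apply/andP; split; lra.
Qed.

Lemma unif_ae : {ae unif, forall u, 0 < u <= 1}.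
Proof.
exists (~` `]0, 1]); split; first exact: measurableC.
  by rewrite probability_setC// unif_itv// subr0 subee.
by move=> u /= /negP; rewrite in_itv/= => /negP.
Qed.

Lemma unif_le (A : set (measurableTypeR R)) : measurable A ->
  (unif A <= lebesgue_measure A)%E.
Proof.
move=> mA; rewrite unifE//; apply: le_measure; rewrite ?inE//.
exact: measurableI.
Qed.

Lemma unif_Nitv (c : R) : 0 <= c <= 1 -> unif `]-oo, c]%classic = c%:E.
Proof.
move=> /andP[c0 c1]; rewrite unifE// (_ : _ `&` _ = `[0, c]%classic); last first.
  apply/seteqP; split => x /=; rewrite !in_itv/=.
    by move=> [xc /andP[x0 x1]]; rewrite x0 xc.
  by move=> /andP[x0 xc]; rewrite xc x0 (le_trans xc).
rewrite lebesgue_measure_itv/= lte_fin; case: ltgtP c0 => // [_|<-] _.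
  by rewrite oppr0 adde0.
by [].
Qed.

(** The rays []x, +oo[] are stable under intersection and generate the Borel sets; their masses are
    complementary to the given ones. *)
Lemma probability_eq_cdf (m1 m2 : probability (measurableTypeR R) R) :
  (forall z : R, m1 `]-oo, z]%classic = m2 `]-oo, z]%classic) ->
  forall A, measurable A -> m1 A = m2 A.
Proof.
move=> m12 A mA.
apply: (@measure_unique _ R (measurableTypeR R) (@RGenOInfty.G R)
  (fun n => `]- n%:R, +oo[%classic) _ _ _ _ m1 m2 _ _ A mA) => //.
- exact: RGenOInfty.measurableE.
- move=> _ _ [x ->] [y ->]; exists (Num.max x y).
  by apply/seteqP; split => z /=; rewrite !in_itv/= !andbT gt_max => /andP.
- by move=> n; exists (- n%:R).
- apply/seteqP; split => // z _; exists (Num.bound `|z|) => //=.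
  rewrite in_itv/= andbT ltrNl; apply: le_lt_trans (ler_norm _) _.
  by rewrite normrN; exact: archi_boundP.
- move=> _ [x ->]; transitivity (1 - m1 `]-oo, x]%classic)%E.
    by rewrite -setCitvl; exact: probability_setC.
  rewrite m12 -setCitvl; apply/esym; exact: probability_setC.
- by move=> k; apply: le_lt_trans (probability_le1 _ _) _; rewrite ?ltry.
Qed.
End uniform.

(** * Laws of quantile functions and of expanding maps *)

Section law.
Context {R : realType}.

Lemma ae_le_measure d (T : measurableType d) (mu : {measure set T -> \bar R})
    (A B : set T) : measurable A -> measurable B ->
  {ae mu, forall x, A x -> B x} -> (mu A <= mu B)%E.
Proof.
move=> mA mB [N [mN N0 sN]].
apply: (@le_trans _ _ (mu (B `|` N))).
  apply: le_measure; rewrite ?inE//; first exact: measurableU.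
  move=> x Ax; have [Bx|nBx] := pselect (B x); first by left.
  by right; apply: sN => /= AB; apply/nBx/AB.
by rewrite -[leRHS]adde0 -N0; exact: measureU2.
Qed.

Lemma ae_eq_measure d (T : measurableType d) (mu : {measure set T -> \bar R})
    (A B : set T) : measurable A -> measurable B ->
  {ae mu, forall x, A x <-> B x} -> mu A = mu B.
Proof.
move=> mA mB AB; apply/eqP; rewrite eq_le; apply/andP; split.
- by apply: ae_le_measure => //; apply: filterS AB => x [].
- by apply: ae_le_measure => //; apply: filterS AB => x [].
Qed.

Lemma unif_subset (A B : set (measurableTypeR R)) :
  measurable A -> measurable B ->
  (forall u : R, 0 < u <= 1 -> A u -> B u) -> (unif A <= unif B)%E.
Proof.
move=> mA mB AB; apply: ae_le_measure => //.
have F : Filter (almost_everywhere (unif : set (measurableTypeR R) -> \bar R)).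
  exact: ae_filter_ringOfSetsType.
by apply: (@filterS _ _ F) (@unif_ae R).
Qed.

Lemma unif_eq (A B : set (measurableTypeR R)) :
  measurable A -> measurable B ->
  (forall u : R, 0 < u <= 1 -> A u <-> B u) -> unif A = unif B.
Proof.
move=> mA mB AB; apply/eqP; rewrite eq_le; apply/andP; split.
- by apply: unif_subset => // u /AB[].
- by apply: unif_subset => // u /AB[].
Qed.

Lemma eq_law d1 d2 (T1 : measurableType d1) (T2 : measurableType d2)
    (P1 : probability T1 R) (P2 : probability T2 R)
    (X1 : T1 -> measurableTypeR R) (X2 : T2 -> measurableTypeR R) :
  measurable_fun setT X1 -> measurable_fun setT X2 ->
  (forall z, P1 [set t | X1 t <= z] = P2 [set t | X2 t <= z]) ->
  forall A, measurable A -> P1 (X1 @^-1` A) = P2 (X2 @^-1` A).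
Proof.
move=> mX1 mX2 X12 A mA.
pose f1 : {mfun T1 >-> measurableTypeR R} :=
  HB.pack X1 (isMeasurableFun.Build _ _ _ _ _ mX1).
pose f2 : {mfun T2 >-> measurableTypeR R} :=
  HB.pack X2 (isMeasurableFun.Build _ _ _ _ _ mX2).
apply: (@probability_eq_cdf R (distribution P1 f1) (distribution P2 f2)).
have E (T : Type) (X : T -> measurableTypeR R) z :
    X @^-1` `]-oo, z]%classic = [set t | X t <= z].
  by apply/seteqP; split => t /=; rewrite in_itv.
  by move=> z; rewrite /= /distribution /pushforward/= !E.
by [].
Qed.

Lemma dist_fun_quantile tf (F : R -> R) z : 0 < tf -> is_cdf tf F ->
  unif [set u | quantile F u <= z] = (F z)%:E.
Proof.
move=> tf0 cF.
rewrite -(unif_Nitv (c := F z)) ?(is_cdf_ge0 _ cF) ?(is_cdf_le1 _ cF)//.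
apply: unif_eq => //.
  exact: measurable_le_fun (measurable_quantile tf0 cF) z.
move=> u u01; rewrite /= in_itv/=.
by rewrite (quantile_le _ tf0 cF u01).
Qed.

(** By the Galois connection [quantile_le], both laws have the distribution function
    [dist_fun P X]. *)
Lemma law_quantile d (T : measurableType d) (P : probability T R)
    (X : T -> measurableTypeR R) tf : 0 < tf -> measurable_fun setT X ->
  is_cdf tf (dist_fun P X) ->
  forall A, measurable A -> unif (quantile (dist_fun P X) @^-1` A) = P (X @^-1` A).
Proof.
move=> tf0 mX cF A mA; have mQ := measurable_quantile tf0 cF.
apply: (eq_law mQ mX) => // z.
by rewrite (dist_fun_quantile _ tf0 cF) dist_funE.
Qed.

(* The image of [unif] under a map expanding by [r^-1] has density at most [r]:
   the preimage of an interval of length [l] has diameter at most [r * l]. *)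
Lemma expand_law_le (f : measurableTypeR R -> measurableTypeR R) r :
  measurable_fun setT f -> 0 < r ->
  (forall u v, 0 < u -> u < v -> v <= 1 -> v - u <= r * (f v - f u)) ->
  forall A, measurable A -> (unif (f @^-1` A) <= r%:E * lebesgue_measure A)%E.
Proof.
move=> mf r0 fexp A mA.
have mpre B : measurable B -> measurable (f @^-1` B).
  by move=> mB; rewrite -[X in measurable X]setTI; exact: mf.
(* The part [E] of the preimage in ]0, 1] has diameter at most [r * (b - a)], so it lies in an
   interval of that length starting at its infimum. *)
have itv_le a b : a <= b -> (unif (f @^-1` `]a, b]%classic) <= (r * (b - a))%:E)%E.
  move=> ab; pose E := [set u | 0 < u <= 1 /\ a < f u <= b].
  have diam u v : E u -> E v -> u <= v -> v - u <= r * (b - a).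
    move=> [/andP[u0 u1] /andP[afu fub]] [/andP[v0 v1] /andP[afv fvb]].
    rewrite le_eqVlt => /predU1P[->|uv].
      by rewrite subrr mulr_ge0 ?subr_ge0// ltW.
    apply: le_trans (fexp u v u0 uv v1) _.
    by rewrite ler_pM2l//; lra.
  have [[u0 Eu0]|/set0P/negP/negPn/eqP E0] := pselect (E !=set0); last first.
    rewrite (_ : unif _ = 0%E) ?lee_fin ?mulr_ge0 ?subr_ge0// ?ltW//.
    apply/eqP; rewrite eq_le measure_ge0 andbT -(measure0 unif).
    apply: unif_subset => //; first exact: mpre.
    move=> u u01; rewrite /= in_itv/= => fu.
    by have : E u by []; rewrite E0.
  have infE : has_inf E by split; [exists u0|exists 0 => u [/andP[/ltW]]].
  pose i := inf E.
  apply: (@le_trans _ _ (unif `[i, i + r * (b - a)]%classic)).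
    apply: unif_subset => //; first exact: mpre.
    move=> u u01; rewrite /= in_itv/= => fu.
    have Eu : E u by [].
    rewrite in_itv/= ge_inf//=; last exact: (proj2 infE).
    rewrite -lerBlDr; apply: lb_le_inf; first by exists u.
    move=> v Ev; have [uv|/ltW vu] := leP u v.
      rewrite lerBlDr ler_wpDr// mulr_ge0 ?subr_ge0// ltW//.
    by have := diam _ _ Ev Eu vu; lra.
  apply: (le_trans (unif_le _)) => //.
  rewrite lebesgue_measure_itv/= lte_fin; case: ifP => _.
    by rewrite -EFinB addrAC subrr add0r.
  by rewrite lee_fin mulr_ge0 ?subr_ge0// ltW.
rewrite muleC -lee_pdivrMr//.
(* Lebesgue measure is an infimum over countable covers by half-open intervals, so [itv_le] and
   countable subadditivity suffice. *)
rewrite /lebesgue_measure /lebesgue_stieltjes_measure /measure_extension /=.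
apply: le_ereal_inf_tmp => _ [F [mF AF] <-].
rewrite lee_pdivrMr// muleC -nneseriesZl//.
apply: (@le_trans _ _ (\sum_(k <oo) unif (f @^-1` F k))%E).
  apply: measure_sigma_subadditive => //.
  - by move=> k; apply: mpre; apply: sub_sigma_algebra; exact: mF.
  - exact: mpre.
  - by rewrite -preimage_bigcup; exact: preimage_subset.
apply: lee_nneseries => // k _.
have [[a b] /= _ <-] := mF k.
have [ab|/ltW ba] := leP a b.
  by rewrite wlength_itv_bnd//= itv_le.
by rewrite set_itv_ge -?leNgt// preimage_set0 measure0 wlength0 mule0.
Qed.

End law.

(** * The monotone rearrangement inequality *)

Section invgap.
Context {R : realType}.
Implicit Types x y a s : R.

Definition invgap x y : \bar R := if x < y then (y - x)^-1%:E else +oo%E.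

Lemma invgap_ge0 x y : (0 <= invgap x y)%E.
Proof.
by rewrite /invgap; case: ifPn => // xy; rewrite lee_fin invr_ge0 subr_ge0 ltW.
Qed.

(** The extension of 1/a by 0 to [a <= 0] is measurable on the whole line. *)
Definition posinv a : R := if 0 < a then a^-1 else 0.

Lemma posinv_ge0 a : 0 <= posinv a.
Proof. by rewrite /posinv; case: ifPn => // /ltW; rewrite invr_ge0. Qed.

Lemma measurable_posinv : measurable_fun setT posinv.
Proof.
apply: measurable_fun_if => //.
- exact: measurable_fun_ltr.
- rewrite setTI (_ : _ @^-1` _ = `]0, +oo[%classic).
    apply: open_continuous_measurable_fun; first exact: interval_open.
    move=> x; rewrite inE/= in_itv/= andbT => x0; apply: inv_continuous.
    by rewrite gt_eqF.
  by apply/seteqP; split => x /=; rewrite in_itv/= andbT.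
Qed.

Lemma measurable_invgap d (T : measurableType d)
    (X Y : T -> measurableTypeR R) : measurable_fun setT X ->
  measurable_fun setT Y -> measurable_fun setT (fun t => invgap (X t) (Y t)).
Proof.
move=> mX mY.
rewrite (_ : (fun t => _) =
    (fun t => if X t < Y t then (posinv (Y t - X t))%:E else +oo%E)).
  apply: measurable_fun_ifT => //; first exact: measurable_fun_ltr.
  apply/measurable_EFinP.
  apply: (measurableT_comp measurable_posinv); exact: measurable_funB.
apply/funext => t; rewrite /invgap /posinv subr_gt0.
by case: ifP.
Qed.

(* The second derivative 2/a^3 of 1/a, extended by 0 to a <= 0: it is the weight
   expressing the convex function 1/s as a mixture of the max 0 (a - s). *)
Definition gapw a : R := 2 * posinv a ^+ 3.

Lemma gapw_ge0 a : 0 <= gapw a.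
Proof. by rewrite mulr_ge0// exprn_ge0// posinv_ge0. Qed.

Lemma measurable_gapw : measurable_fun setT gapw.
Proof.
apply: measurable_funM => //; apply: measurable_funX; exact: measurable_posinv.
Qed.

Let is_deriveV (x : R) : 0 < x -> is_derive x 1 (@GRing.inv R) (- x ^- 2).
Proof.
move=> x0; have xn0 : x != 0 by rewrite gt_eqF.
apply: DeriveDef; first exact: derivableV.
rewrite deriveV//= derive_id.
by rewrite /GRing.scale/= mulr1.
Qed.

Lemma integral_gapw s : 0 < s ->
  (\int[lebesgue_measure]_a (gapw a * Num.max 0 (a - s))%:E)%E = s^-1%:E.
Proof.
move=> s0.
pose f a := 2 * posinv a ^+ 3 * (a - s).
(* A primitive of 2 (a - s) / a^3 on ]0, +oo[; it equals -1/s at [s] and tends to 0 at infinity. *)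
pose F a := - 2 * a^-1 + s * (a^-1 * a^-1).
have -> : (fun a => (gapw a * Num.max 0 (a - s))%:E) =
    ((fun a => (f a)%:E) \_ (`[s, +oo[ : set R)).
  apply/funext => a; rewrite patchE; case: ifPn.
    rewrite inE/= in_itv/= andbT => sa.
    by rewrite /gapw max_r// subr_ge0.
  rewrite notin_setE/= in_itv/= andbT => /negP; rewrite -ltNge => /ltW sa.
  by rewrite max_l ?mulr0// subr_le0.
rewrite -integral_mkcond.
have cpi (x : R) : 0 < x -> posinv @ x --> posinv x.
  move=> x0; rewrite /posinv x0; apply: cvg_trans (@inv_continuous R x _).
    apply: near_eq_cvg; near=> y; rewrite /posinv ifT//.
    by near: y; exact: lt_nbhsr.
  by rewrite gt_eqF.
have cf (x : R) : 0 < x -> f @ x --> f x.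
  move=> x0; apply: cvgM; last by apply: cvgB; [exact: cvg_id|exact: cvg_cst].
  apply: cvgM; first exact: cvg_cst.
  exact: (cvgM (cpi x x0) (cvgM (cpi x x0) (cpi x x0))).
have dF (x : R) : s < x -> is_derive x 1 F (f x).
  move=> sx; have x0 : 0 < x by exact: lt_trans sx.
  have := is_deriveV x0 => H.
  apply: is_derive_eq.
  rewrite /f /posinv x0 /GRing.scale/=.
  field; rewrite gt_eqF//. 
have cF (x : R) : 0 < x -> F @ x --> F x.
  move=> x0; have ci := @inv_continuous R x (lt0r_neq0 x0).
  apply: cvgD; first by apply: cvgM => //; exact: cvg_cst.
  by apply: cvgM; [exact: cvg_cst|exact: cvgM].
rewrite (@ge0_continuous_FTC2y R f F s 0).
- by rewrite add0e /F -EFinN; congr EFin; field; rewrite gt_eqF.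
- move=> x sx; rewrite /f mulr_ge0 ?subr_ge0//.
  by rewrite mulr_ge0 ?exprn_ge0 ?posinv_ge0.
- apply: continuous_in_subspaceT => x; rewrite inE/= in_itv/= andbT => sx.
  by apply: cf; exact: lt_le_trans sx.
- have ci : (x^-1 : R) @[x --> +oo] --> 0.
    by apply/gtr0_cvgV0; [near=> x|exact: cvg_id].
  rewrite /F (_ : 0 = - 2 * 0 + s * (0 * 0)); last by rewrite !mulr0 addr0.
  apply: cvgD; first by apply: cvgM => //; exact: cvg_cst.
  by apply: cvgM; [exact: cvg_cst|exact: cvgM].
- by move=> x sx; have := dF x sx => -[].
- by apply: cvg_at_right_filter; exact: cF.
- move=> x; rewrite in_itv/= andbT => sx; rewrite derive1E.
  by have := dF x sx => -[].
Unshelve. all: by end_near.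
Qed.

(** For [x < y] this is [integral_gapw] at s = y - x. Otherwise the integrand dominates that of
    [integral_gapw] for every s > 0, and the values 1/s are unbounded. *)
Lemma invgap_kernel x y :
  (\int[lebesgue_measure]_a (gapw a * Num.max 0 (x - y + a))%:E)%E = invgap x y.
Proof.
rewrite /invgap; case: ltP => [xy|yx].
  rewrite -integral_gapw ?subr_gt0//; apply: eq_integral => a _.
  by rewrite opprB addrC addrA.
apply/eqyP => e e0.
have ei : 0 < e^-1 by rewrite invr_gt0.
rewrite -[in leLHS](invrK e) -integral_gapw//.
have mg z : measurable_fun setT (fun a => (gapw a * Num.max 0 (z + a))%:E).
  apply/measurable_EFinP; apply: measurable_funM; first exact: measurable_gapw.
  by apply: measurable_maxr => //; exact: measurable_funD.
apply: ge0_le_integral => //.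
- by move=> a _; rewrite lee_fin mulr_ge0 ?gapw_ge0// le_max lexx.
- have -> : (fun a => (gapw a * Num.max 0 (a - e^-1))%:E) =
      (fun a => (gapw a * Num.max 0 (- e^-1 + a))%:E).
    by apply/funext => a; rewrite addrC.
  exact: mg.
- exact: mg.
- move=> a _; rewrite lee_fin ler_wpM2l ?gapw_ge0//.
  by rewrite ge_max !le_max lexx/= orbC ltW//; lra.
Qed.

End invgap.

(** * The pair cost as a mixture of box probabilities *)

Section monge.
Context {R : realType}.
Local Notation leb := (@lebesgue_measure R).

Lemma measurable_bool_set d (T : measurableType d) (f : T -> bool) :
  measurable_fun setT f -> measurable [set t | f t].
Proof.
move=> mf; rewrite (_ : [set t | f t] = setT `&` f @^-1` [set true]).
  exact: mf.
by rewrite setTI; apply/seteqP; split => t /=.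
Qed.

Lemma measurable_box d (T : measurableType d) (X Y : T -> measurableTypeR R)
    (z w : R) : measurable_fun setT X -> measurable_fun setT Y ->
  measurable [set t | z < X t /\ Y t <= w].
Proof.
by move=> mX mY; exact: measurableI (measurable_gt_fun mX z) (measurable_le_fun mY w).
Qed.

(** [Num.max 0 (X t - Y t + b)] is the length of the interval [[Y t - b, X t[]; Tonelli's theorem
    exchanges the integral of its indicator with the expectation. *)
Lemma integral_max0 d (T : measurableType d) (P : probability T R)
    (X Y : T -> measurableTypeR R) (b : R) :
  measurable_fun setT X -> measurable_fun setT Y ->
  (\int[P]_t (Num.max 0 (X t - Y t + b))%:E =
   \int[leb]_z P [set t | (z < X t)%R /\ (Y t <= z + b)%R])%E.
Proof.
move=> mX mY.
pose E := [set p : T * measurableTypeR R | (p.2 < X p.1) && (Y p.1 <= p.2 + b)].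
have mE : measurable E.
  apply: measurable_bool_set; apply: measurable_and.
    apply: measurable_fun_ltr => //; exact: measurableT_comp.
  apply: measurable_fun_ler; first exact: measurableT_comp.
  by apply: measurable_funD.
pose f (p : T * measurableTypeR R) := (\1_E p)%:E : \bar R.
have mf : measurable_fun setT f.
  by apply/measurable_EFinP; exact: measurable_indic.
have f0 p : (0 <= f p)%E by rewrite lee_fin.
have := @fubini_tonelli _ _ _ _ R P leb f mf f0.
under eq_integral => t _.
  rewrite (_ : (\int[leb]_y _)%E = (Num.max 0 (X t - Y t + b))%:E); last first.
    rewrite (eq_integral (fun z : measurableTypeR R => (\1_`[Y t - b, X t[%classic z)%:E)); last first.
      move=> z _; rewrite /f !indicE; congr ((nat_of_bool _)%:R%:E).
      by apply/idP/idP; rewrite !inE/= /E/= in_itv/= lerBlDr andbC.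
    rewrite integral_indic//= setIT lebesgue_measure_itv/= lte_fin.
    case: ifPn => [h|]; first by rewrite -EFinB max_r; [congr EFin|]; lra.
    by rewrite -leNgt => h; rewrite max_l//; lra.
  over.
move=> ->; apply: eq_integral => z _.
rewrite /f; transitivity (\int[P]_t (\1_[set t | (z < X t)%R /\ (Y t <= z + b)%R] t)%:E)%E.
  apply: eq_integral => t _; rewrite !indicE; congr ((nat_of_bool _)%:R%:E).
  by apply/idP/idP; rewrite !inE/= /E/= => /andP.
by rewrite integral_indic ?setIT//; exact: measurable_box.
Qed.

(** The weights [gapw a] are nonnegative, so this form lets two couplings be compared box by box. *)
Lemma integral_invgap d (T : measurableType d) (P : probability T R)
    (X Y : T -> measurableTypeR R) :
  measurable_fun setT X -> measurable_fun setT Y ->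
  (\int[P]_t invgap (X t) (Y t) =
   \int[leb]_a ((gapw a)%:E * \int[leb]_z P [set t | (z < X t)%R /\ (Y t <= z + a)%R]))%E.
Proof.
move=> mX mY.
pose f (p : T * measurableTypeR R) :=
  (gapw p.2 * Num.max 0 (X p.1 - Y p.1 + p.2))%:E.
have mf : measurable_fun setT f.
  apply/measurable_EFinP; apply: measurable_funM.
    by apply: (measurableT_comp measurable_gapw).
  apply: measurable_maxr => //; apply: measurable_funD => //.
  by apply: measurable_funB; exact: measurableT_comp.
have f0 p : (0 <= f p)%E by rewrite lee_fin mulr_ge0 ?gapw_ge0// le_max lexx.
have := @fubini_tonelli _ _ _ _ R P leb f mf f0.
under eq_integral do rewrite /f/= invgap_kernel.
move=> ->; apply: eq_integral => a _; rewrite /f/=.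
under eq_integral do rewrite EFinM.
rewrite ge0_integralZl//; first by rewrite integral_max0.
- apply/measurable_EFinP; apply: measurable_maxr => //; apply: measurable_funD => //.
  exact: measurable_funB.
- by move=> t _; rewrite lee_fin le_max lexx.
- by rewrite lee_fin gapw_ge0.
Qed.
End monge.

Section monge_inequality.
Context {R : realType}.
Local Notation leb := (@lebesgue_measure R).

Lemma measurable_box_prob d (T : measurableType d) (P : probability T R)
    (X Y : T -> measurableTypeR R) (b : R) :
  measurable_fun setT X -> measurable_fun setT Y ->
  measurable_fun setT (fun z : measurableTypeR R => P [set t | z < X t /\ Y t <= z + b]).
Proof.
move=> mX mY.
pose E := [set p : measurableTypeR R * T | (p.1 < X p.2) && (Y p.2 <= p.1 + b)].
have mE : measurable E.
  apply: measurable_bool_set; apply: measurable_and.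
    apply: measurable_fun_ltr => //; exact: measurableT_comp.
  apply: measurable_fun_ler; first exact: measurableT_comp.
  by apply: measurable_funD.
have := measurable_fun_xsection P mE; congr measurable_fun.
apply/funext => z /=; congr (P _).
apply/seteqP; split => t; rewrite /xsection/= /E/= inE/= => /andP //.
Qed.

Lemma measurable_gap_integrand d (T : measurableType d) (P : probability T R)
    (X Y : T -> measurableTypeR R) :
  measurable_fun setT X -> measurable_fun setT Y ->
  measurable_fun setT (fun a : measurableTypeR R => (gapw a)%:E *
    \int[leb]_z P [set t | (z < X t)%R /\ (Y t <= z + a)%R])%E.
Proof.
move=> mX mY.
apply: emeasurable_funM; first by apply/measurable_EFinP; exact: measurable_gapw.
pose f (p : T * measurableTypeR R) := (Num.max 0 (X p.1 - Y p.1 + p.2))%:E.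
have mf : measurable_fun setT f.
  apply/measurable_EFinP; apply: measurable_maxr => //; apply: measurable_funD => //.
  by apply: measurable_funB; exact: measurableT_comp.
have f0 p : (0 <= f p)%E by rewrite lee_fin le_max lexx.
have := @measurable_fun_fubini_tonelli_G _ _ _ _ R P f mf f0; congr measurable_fun.
by apply/funext => a; rewrite /fubini_G/= /f/= integral_max0.
Qed.

Section couplings.
Context d (T : measurableType d) (P : probability T R).
Variables X Y : T -> measurableTypeR R.
Hypotheses (mX : measurable_fun setT X) (mY : measurable_fun setT Y).
Variables (tf : R) (tf0 : 0 < tf).
Hypotheses (cX : is_cdf tf (dist_fun P X)) (cY : is_cdf tf (dist_fun P Y)).

Local Notation QX := (quantile (dist_fun P X)).
Local Notation QY := (quantile (dist_fun P Y)).

(** By [quantile_le] the box event is, within ]0, 1], the interval between the level of [X] at [z]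
    and the level of [Y] at [w]. *)
Lemma quantile_box z w : unif [set u | z < QX u /\ QY u <= w] =
  (Num.max 0 (dist_fun P Y w - dist_fun P X z))%:E.
Proof.
have := is_cdf_ge0 z cX; have := is_cdf_le1 w cY.
set x := dist_fun P X z; set y := dist_fun P Y w => y1 x0.
have mB := measurable_box z w (measurable_quantile tf0 cX) (measurable_quantile tf0 cY).
have -> : unif [set u | z < QX u /\ QY u <= w] = unif `]x, y]%classic.
  apply: unif_eq => // u u01 /=.
  rewrite in_itv/= ltNge (quantile_le _ tf0 cX u01) (quantile_le _ tf0 cY u01) -ltNge.
  by split => [[-> ->]|/andP].
have [xy|yx] := leP x y.
  by rewrite unif_itv// max_r// subr_ge0.
by rewrite set_itv_ge -?leNgt ?bnd_simp ?ltW// measure0 max_l// subr_le0 ltW.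
Qed.

(* The minimum measures the failure of monotonicity of the coupling at (z, w). *)
Lemma box_excess z w : P [set t | z < X t /\ Y t <= w] =
  ((Num.max 0 (dist_fun P Y w - dist_fun P X z))%:E +
   Order.min (P [set t | (z < X t)%R /\ (Y t <= w)%R])
             (P [set t | (w < Y t)%R /\ (X t <= z)%R]))%E.
Proof.
have mA := measurable_box z w mX mY; have mB := measurable_box w z mY mX.
have mC : measurable ([set t | X t <= z] `&` [set t | Y t <= w]).
  by apply: measurableI; exact: measurable_le_fun.
set A := [set t | _] in mA *; set B := [set t | _] in mB *.
set C := _ `&` _ in mC.
(* With a = P A and b = P B, the two distribution functions are a and b shifted by the same P C, so
   the claim becomes a = max 0 (a - b) + min a b. *)
have EY : dist_fun P Y w = fine (P A) + fine (P C).
  apply: EFin_inj; rewrite dist_funE// EFinD !fineK ?fin_num_measure//.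
  rewrite -measureU//; last first.
    by apply/seteqP; split => t //= [[+ _] [+ _]]; rewrite /= ltNge => /negP.
  congr (P _); apply/seteqP; split => t /=; last by move=> [[]|[]].
  by move=> h; case: (leP (X t) z) => h'; [right|left].
have EX : dist_fun P X z = fine (P B) + fine (P C).
  apply: EFin_inj; rewrite dist_funE// EFinD !fineK ?fin_num_measure//.
  rewrite -measureU//; last first.
    by apply/seteqP; split => t //= [[+ _] [_ +]]; rewrite /= ltNge => /negP.
  congr (P _); apply/seteqP; split => t /=; last by move=> [[]|[]].
  by move=> h; case: (leP (Y t) w) => h'; [right|left].
rewrite EX EY -(fineK (fin_num_measure P _ mA)) -(fineK (fin_num_measure P _ mB)).
rewrite -EFin_min -EFinD; congr EFin.
move: (fine (P A)) (fine (P B)) => a b /=.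
by case: (leP a b) => ab; [rewrite max_l|rewrite max_r]; lra.
Qed.

Lemma quantile_box_le z w : (unif [set u | (z < QX u)%R /\ (QY u <= w)%R] <=
  P [set t | (z < X t)%R /\ (Y t <= w)%R])%E.
Proof.
rewrite quantile_box box_excess leeDl//.
by rewrite le_min !measure_ge0.
Qed.

Lemma quantile_invgap_le :
  (\int[unif]_u invgap (QX u) (QY u) <= \int[P]_t invgap (X t) (Y t))%E.
Proof.
have mQX := measurable_quantile tf0 cX; have mQY := measurable_quantile tf0 cY.
rewrite !integral_invgap//; apply: ge0_le_integral => //.
- move=> a _; rewrite mule_ge0 ?lee_fin ?gapw_ge0//.
  by apply: integral_ge0 => z _.
- exact: measurable_gap_integrand.
- exact: measurable_gap_integrand.
move=> a _; apply: lee_wpmul2l; first by rewrite lee_fin gapw_ge0.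
apply: ge0_le_integral => //.
- exact: measurable_box_prob.
- exact: measurable_box_prob.
- by move=> z _; exact: quantile_box_le.
Qed.

End couplings.
End monge_inequality.

(** * Strict inequality for couplings that are not monotone *)

Section monge_equality.
Context {R : realType}.
Local Notation leb := (@lebesgue_measure R).

(** The event is the countable union of the events with thresholds strictly to the right of [z],
    which cannot all be null. *)
Lemma box_right d (T : measurableType d) (P : probability T R)
    (X Y : T -> measurableTypeR R) (z w : R) :
  measurable_fun setT X -> measurable_fun setT Y ->
  (0 < P [set t | (z < X t)%R /\ (Y t <= w)%R])%E ->
  exists2 z', z < z' & (0 < P [set t | (z' < X t)%R /\ (Y t <= w)%R])%E.
Proof.
move=> mX mY P0; apply: contrapT => /forall2NP H.
pose F k := [set t | z + k.+1%:R^-1 < X t /\ Y t <= w].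
have F0 k : P (F k) = 0%E.
  have [|/negP] := H (z + k.+1%:R^-1); first by rewrite ltrDl invr_gt0 ltr0n.
  by rewrite -leNgt => Fk; apply/eqP; rewrite eq_le Fk measure_ge0.
have mF k : measurable (F k) by exact: measurable_box.
have : (P [set t | (z < X t)%R /\ (Y t <= w)%R] <= \sum_(k <oo) P (F k))%E.
  apply: measure_sigma_subadditive => //; first exact: measurable_box.
  by move=> t /= [/ltr_add_invr[k zk] Yw]; exists k.
by rewrite eseries0 ?leNgt ?P0// => k _ _; exact: F0.
Qed.

Section couplings.
Context d (T : measurableType d) (P : probability T R).
Variables X Y : T -> measurableTypeR R.
Hypotheses (mX : measurable_fun setT X) (mY : measurable_fun setT Y).
Variables (tf : R) (tf0 : 0 < tf).
Hypotheses (cX : is_cdf tf (dist_fun P X)) (cY : is_cdf tf (dist_fun P Y)).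

Local Notation QX := (quantile (dist_fun P X)).
Local Notation QY := (quantile (dist_fun P Y)).

(** The two crossing events persist on a small rectangle of parameters [(a, z')], where [box_excess]
    gives an excess bounded below. Finiteness of the quantile cost turns this into a strict
    inequality. *)
Lemma quantile_invgap_lt z w : z < w ->
  (0 < P [set t | (z < X t)%R /\ (Y t <= w)%R])%E ->
  (0 < P [set t | (w < Y t)%R /\ (X t <= z)%R])%E ->
  (\int[unif]_u invgap (QX u) (QY u) < +oo)%E ->
  (\int[unif]_u invgap (QX u) (QY u) < \int[P]_t invgap (X t) (Y t))%E.
Proof.
move=> zw PA PB Efin.
have [z1 zz1 PA1] := box_right mX mY PA.
have [w1 ww1 PB1] := box_right mY mX PB.
have mQX := measurable_quantile tf0 cX; have mQY := measurable_quantile tf0 cY.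
pose dl := Num.min (fine (P [set t | z1 < X t /\ Y t <= w]))
                   (fine (P [set t | w1 < Y t /\ X t <= z])).
have dl0 : 0 < dl.
  rewrite lt_min; apply/andP; split; rewrite fine_gt0//; apply/andP; split => //.
    by rewrite (le_lt_trans (probability_le1 _ _)) ?ltry//; exact: measurable_box.
  by rewrite (le_lt_trans (probability_le1 _ _)) ?ltry//; exact: measurable_box.
(* Half the smaller margin: for [z'] in [J] and [a] in [I], [z'] stays below [z1] and [z' + a] lies
   between [w] and [w1]. *)
pose e := Num.min (z1 - z) (w1 - w) / 2.
have e0 : 0 < e by rewrite divr_gt0// lt_min !subr_gt0 zz1.
have ez1 : z + e + e <= z1.
  by rewrite -addrA -splitr -lerBrDl ge_min lexx.
have ew1 : w + e + e <= w1.
  by rewrite -addrA -splitr -lerBrDl ge_min lexx orbT.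
pose J : set (measurableTypeR R) := `]z, z + e]%classic.
pose I : set (measurableTypeR R) := `]w - z, w - z + e]%classic.
have mI0 : measurable I by exact: measurable_itv.
have mJ0 : measurable J by exact: measurable_itv.
(* [gapw] decreases on positive numbers, so its minimum on [I] is at the right end. *)
pose g0 := 2 * posinv (w - z + e) ^+ 3.
have g00 : 0 < g0.
  by rewrite mulr_gt0// exprn_gt0// /posinv ifT ?invr_gt0; lra.
have gI a : I a -> g0 <= gapw a.
  rewrite /I/= in_itv/= => /andP[a1 a2]; rewrite ler_wpM2l//.
  rewrite lerXn2r ?nnegrE ?posinv_ge0// /posinv !ifT ?lef_pV2 ?posrE//; lra.
have excess a z' : I a -> J z' ->
    (unif [set u | (z' < QX u)%R /\ (QY u <= z' + a)%R] + dl%:E <=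
      P [set t | (z' < X t)%R /\ (Y t <= z' + a)%R])%E.
  rewrite /I /J/= !in_itv/= => /andP[a1 a2] /andP[z1' z2'].
  rewrite (quantile_box tf0 cX cY) [leRHS]box_excess// leeD2l//.
  rewrite /dl EFin_min !fineK ?fin_num_measure//; [|exact: measurable_box..].
  rewrite le_min !ge_min; apply/andP; split; apply/orP; [left|right].
    apply: le_measure; rewrite ?inE; [exact: measurable_box..|].
    by move=> t /= [h1 h2]; split; lra.
  apply: le_measure; rewrite ?inE; [exact: measurable_box..|].
  by move=> t /= [h1 h2]; split; lra.
(* The least weight times the excess times the two side lengths of the rectangle. *)
pose c := g0 * (dl * e) * e.
have c0 : 0 < c by do 3?[apply: mulr_gt0 => //].
suff : (\int[unif]_u invgap (QX u) (QY u) + c%:E <= \int[P]_t invgap (X t) (Y t))%E.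
  apply: lt_le_trans; rewrite lteDl ?lte_fin// fin_numElt Efin andbT.
  by rewrite (lt_le_trans (ltNyr 0))// integral_ge0// => u _; exact: invgap_ge0.
rewrite !integral_invgap//.
have -> : (c%:E = \int[leb]_a ((g0 * (dl * e)) * \1_I a)%:E)%E.
  under eq_integral do rewrite EFinM.
  rewrite ge0_integralZl//; last 2 first.
  - by apply/measurable_EFinP; exact: measurable_indic.
  - by rewrite lee_fin ltW// mulr_gt0// mulr_gt0.
  rewrite integral_indic//= setIT lebesgue_measure_itv/= lte_fin ltrDl e0.
  by rewrite -EFinB -EFinM; congr EFin; rewrite /c; ring.
have mU := measurable_gap_integrand unif mQX mQY.
have mP := measurable_gap_integrand P mX mY.
have mI : measurable_fun setT (fun a : measurableTypeR R => ((g0 * (dl * e)) * \1_I a)%:E).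
  apply/measurable_EFinP; apply: measurable_funM => //.
rewrite -ge0_integralD//; last 2 first.
- move=> a _; rewrite mule_ge0 ?lee_fin ?gapw_ge0//.
  by apply: integral_ge0.
- by move=> a _; rewrite lee_fin mulr_ge0// ltW// mulr_gt0// mulr_gt0.
apply: ge0_le_integral => //.
- move=> a _; apply: adde_ge0.
    by rewrite mule_ge0 ?lee_fin ?gapw_ge0//; apply: integral_ge0.
  by rewrite lee_fin mulr_ge0// ltW// mulr_gt0// mulr_gt0.
- exact: emeasurable_funD.
move=> a _.
have mz := measurable_box_prob P a mX mY.
have mzU := measurable_box_prob unif a mQX mQY.
have [aI|aI] := pselect (I a); last first.
  rewrite indicE memNset// mulr0 adde0 lee_wpmul2l ?lee_fin ?gapw_ge0//.
  by apply: ge0_le_integral => // z' _; exact: (quantile_box_le mX mY tf0 cX cY).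
rewrite indicE mem_set// mulr1.
apply: (@le_trans _ _ ((gapw a)%:E *
  ((\int[leb]_z0 unif [set u | (z0 < QX u)%R /\ (QY u <= z0 + a)%R]) +
   (dl * e)%:E))%E).
  rewrite [leRHS]ge0_muleDr; last 2 first.
  - by apply: integral_ge0.
  - by rewrite lee_fin mulr_ge0// ltW.
  by rewrite leeD2l// -EFinM lee_fin ler_wpM2r ?gI// mulr_ge0// ltW.
apply: lee_wpmul2l; first by rewrite lee_fin gapw_ge0.
have -> : ((dl * e)%:E = \int[leb]_z0 (dl * \1_J z0)%:E)%E.
  under eq_integral do rewrite EFinM.
  rewrite ge0_integralZl//; last 2 first.
  - by apply/measurable_EFinP; exact: measurable_indic.
  - by rewrite lee_fin ltW.
  rewrite integral_indic//= setIT lebesgue_measure_itv/= lte_fin ltrDl e0.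
  by rewrite -EFinB -EFinM; congr EFin; ring.
have mJ : measurable_fun setT (fun z0 : measurableTypeR R => (dl * \1_J z0)%:E).
  by apply/measurable_EFinP; apply: measurable_funM.
rewrite -ge0_integralD//; last by move=> z' _; rewrite lee_fin mulr_ge0// ltW.
apply: ge0_le_integral => //.
- by move=> z' _; rewrite adde_ge0// lee_fin mulr_ge0// ltW.
- exact: emeasurable_funD.
move=> z' _; have [zJ|zJ] := pselect (J z'); last first.
  by rewrite indicE memNset// mulr0 adde0; exact: (quantile_box_le mX mY tf0 cX cY).
by rewrite indicE mem_set// mulr1; exact: excess.
Qed.

End couplings.
End monge_equality.

(** * Optimal couplings of two coordinates *)

Section monge_coupling.
Context {R : realType} d (T : measurableType d) (P : probability T R).
Variables X Y : T -> measurableTypeR R.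
Hypotheses (mX : measurable_fun setT X) (mY : measurable_fun setT Y).
Variables (tf : R) (tf0 : 0 < tf).
Hypotheses (cX : is_cdf tf (dist_fun P X)) (cY : is_cdf tf (dist_fun P Y)).
Hypothesis finXY : (\int[P]_t invgap (X t) (Y t) < +oo)%E.
Hypothesis optXY : (\int[P]_t invgap (X t) (Y t) <=
  \int[unif]_u invgap (quantile (dist_fun P X) u) (quantile (dist_fun P Y) u))%E.

(** For [z < w], two events of positive mass would contradict optimality through
    [quantile_invgap_lt]. For [w <= z], the first event forces [Y t < X t], hence infinite cost, so
    it is null. *)
Lemma optimal_box z w : P [set t | z < X t /\ Y t <= w] = 0%E \/
  P [set t | w < Y t /\ X t <= z] = 0%E.
Proof.
have [zw|wz] := ltP z w; last first.
  left; apply/eqP; rewrite eq_le measure_ge0 andbT -(measure0 P).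
  apply: ae_le_measure => //; first exact: measurable_box.
  have intXY : P.-integrable setT (fun t => invgap (X t) (Y t)).
    apply/integrableP; split; first exact: measurable_invgap.
    by under eq_integral do rewrite gee0_abs ?invgap_ge0//.
  apply: filterS (integrable_ae measurableT intXY) => t /(_ I) + [zX Yw].
  by rewrite /invgap ifF//; apply/negbTE; rewrite -leNgt; lra.
have [A0|A0] := eqVneq (P [set t | z < X t /\ Y t <= w]) 0%E; first by left.
have [B0|B0] := eqVneq (P [set t | w < Y t /\ X t <= z]) 0%E; first by right.
exfalso.
have := quantile_invgap_lt mX mY tf0 cX cY zw.
rewrite !lt0e A0 B0 !measure_ge0 => /(_ isT isT).
rewrite (le_lt_trans (quantile_invgap_le mX mY tf0 cX cY) finXY) => /(_ isT).
by rewrite ltNge optXY.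
Qed.

(** At equal levels [box_excess] gives both crossing events the same mass, and by [optimal_box] one
    of them is null. *)
Lemma optimal_le_eq z w : dist_fun P X z = dist_fun P Y w ->
  {ae P, forall t, (X t <= z) = (Y t <= w)}.
Proof.
move=> zw.
have AE := box_excess P mX mY z w; have BE := box_excess P mY mX w z.
rewrite zw subrr maxxx add0e in AE; rewrite zw subrr maxxx add0e in BE.
have [A0 B0] : P [set t | z < X t /\ Y t <= w] = 0%E /\
    P [set t | w < Y t /\ X t <= z] = 0%E.
  have [A0|B0] := optimal_box z w; split => //.
  - by rewrite BE A0 min_r ?measure_ge0.
  - by rewrite AE B0 min_r ?measure_ge0.
have mA := measurable_box z w mX mY; have mB := measurable_box w z mY mX.
exists ([set t | z < X t /\ Y t <= w] `|` [set t | w < Y t /\ X t <= z]); split.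
- exact: measurableU.
- exact: null_set_setU.
- move=> t /=; case: (leP (X t) z) => Xz; case: (leP (Y t) w) => Yw // _;
    by [right|left].
Qed.

End monge_coupling.

(** * Uniform convexity of the cost *)

Section path_cost.
Context {R : realType} (n : nat).
Variable w : 'I_n.+2 -> 'I_n.+2 -> R.
Hypothesis w0 : forall e : 'I_n.+1, 0 < w (edge_src e) (edge_dst e).
Implicit Types (s t : times R n) (e : 'I_n.+1).

Local Notation we e := (w (edge_src e) (edge_dst e)).

Definition gap e t : R := time (edge_dst e) t - time (edge_src e) t.

Lemma path_costE t : path_cost w t =
  (\sum_(e < n.+1) (we e)%:E * invgap (time (edge_src e) t) (time (edge_dst e) t))%E.
Proof.
rewrite /path_cost; case: ifPn => [/forallP inc|].
  rewrite -sumEFin; apply: eq_bigr => e _.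
  by rewrite /invgap inc -EFinM.
rewrite negb_forall => /existsP[e ne].
(* One infinite term makes the sum infinite, because no term is [-oo]. *)
apply/esym/eqP; rewrite esum_eqy => [|e' _].
  apply/existsP; exists e; rewrite /= /invgap ifN//.
  by rewrite gt0_muley// lte_fin.
apply: contraTneq (_ : 0 <= (we e')%:E *
  invgap (time (edge_src e') t) (time (edge_dst e') t))%E => [->//|].
by rewrite mule_ge0 ?invgap_ge0// lee_fin ltW.
Qed.

Lemma path_cost_ge0 t : (0 <= path_cost w t)%E.
Proof.
by rewrite path_costE sume_ge0// => e _; rewrite mule_ge0 ?invgap_ge0// lee_fin ltW.
Qed.

Lemma measurable_time (l : 'I_n.+2) :
  measurable_fun setT (time l : times R n -> measurableTypeR R).
Proof. exact: measurable_tnth. Qed.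

Lemma measurable_path_cost : measurable_fun setT (path_cost w : times R n -> \bar R).
Proof.
rewrite (funext path_costE).
apply: emeasurable_sum => e; apply: emeasurable_funM => //.
by apply: measurable_invgap; exact: measurable_time.
Qed.

Definition midpoint s t : times R n :=
  [tuple (time l s + time l t) / 2 | l < n.+2].

Lemma time_midpoint l s t : time l (midpoint s t) = (time l s + time l t) / 2.
Proof. by rewrite /time tnth_mktuple. Qed.

(** The convexity defect of the cost is bounded below by a multiple of this quantity. It sees only
    the gaps, so a common shift of all times goes unnoticed. *)
Definition gap_dist s t : R := \sum_(e < n.+1) we e * (gap e s - gap e t) ^+ 2.

Lemma gap_dist_ge0 s t : 0 <= gap_dist s t.
Proof. by apply: sumr_ge0 => e _; rewrite mulr_ge0 ?sqr_ge0// ltW. Qed.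

(** For positive gaps a and b, 1/a + 1/b = 4/(a + b) + (a - b)^2 / (a b (a + b)), and a b (a + b) <=
    2 tf^3. If a gap is not positive, the right-hand side is infinite. *)
Lemma invgap_midpoint tf (x y x' y' : R) : 0 < tf ->
  y - x <= tf -> y' - x' <= tf ->
  (2%:E * invgap ((x + x') / 2) ((y + y') / 2) +
     ((2 * tf ^+ 3)^-1 * ((y - x) - (y' - x')) ^+ 2)%:E <=
   invgap x y + invgap x' y')%E.
Proof.
move=> tf0 atf btf; rewrite /invgap.
have [xy|] := ltP x y; last by rewrite addye ?leey//; case: ifP.
have [xy'|] := ltP x' y'; last by rewrite addey ?leey//.
have -> : (x + x') / 2 < (y + y') / 2 by lra.
rewrite -EFinM -!EFinD lee_fin.
have := atf; have := btf.
have : 0 < y - x by rewrite subr_gt0.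
have : 0 < y' - x' by rewrite subr_gt0.
have -> : (y + y') / 2 - (x + x') / 2 = ((y - x) + (y' - x')) / 2 by lra.
move: (y - x) (y' - x') => a b b0 a0 btf' atf'.
have ab0 : 0 < a * b * (a + b) by rewrite !mulr_gt0// addr_gt0.
have -> : a^-1 + b^-1 = 2 * ((a + b) / 2)^-1 + (a * b * (a + b))^-1 * (a - b) ^+ 2.
  by field; rewrite !gt_eqF ?addr_gt0.
rewrite lerD2l ler_wpM2r ?sqr_ge0// lef_pV2 ?posrE//; last by rewrite mulr_gt0// exprn_gt0.
have : a * b <= tf * tf by rewrite ler_pM// ltW.
have : a + b <= 2 * tf by lra.
move=> h1 h2; have -> : 2 * tf ^+ 3 = (tf * tf) * (2 * tf) by ring.
by rewrite ler_pM// ?mulr_ge0 ?addr_ge0// ltW.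
Qed.

Lemma path_cost_midpoint tf s t : 0 < tf -> time_cube tf s -> time_cube tf t ->
  (2%:E * path_cost w (midpoint s t) + ((2 * tf ^+ 3)^-1 * gap_dist s t)%:E <=
   path_cost w s + path_cost w t)%E.
Proof.
move=> tf0 cs ct.
have gap_le e v : time_cube tf v -> gap e v <= tf.
  move=> cv; have /andP[_ h1] := cv (edge_dst e); have /andP[h2 _] := cv (edge_src e).
  by rewrite /gap; lra.
rewrite !path_costE ge0_sume_distrr; last first.
  by move=> e _; rewrite mule_ge0 ?invgap_ge0// lee_fin ltW.
rewrite /gap_dist mulr_sumr -sumEFin -!big_split/=.
apply: lee_sum => e _.
rewrite -ge0_muleDr ?invgap_ge0//.
have := invgap_midpoint tf0 (gap_le e s cs) (gap_le e t ct).
rewrite -!time_midpoint => /(lee_wpmul2l (ltW (w0 e : 0%E < (we e)%:E)%E)).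
apply: le_trans.
rewrite ge0_muleDr ?lee_fin; last 2 first.
- by rewrite mule_ge0 ?invgap_ge0// lee_fin.
- by rewrite mulr_ge0 ?sqr_ge0// invr_ge0 mulr_ge0// exprn_ge0// ltW.
rewrite muleCA leeD2l// -EFinM lee_fin.
by rewrite le_eqVlt; apply/orP; left; apply/eqP; rewrite /gap; ring.
Qed.

End path_cost.

(** * Limits of costs, limits superior and summability *)

Section limits.
Context {R : realType}.

(** This covers closing gaps: for [b <= a] the gaps are eventually nonpositive or small, so that
    [invgap] exceeds any bound. *)
Lemma cvg_invgap (x y : R^nat) (a b : R) : x @ \oo --> a -> y @ \oo --> b ->
  invgap (x k) (y k) @[k --> \oo] --> invgap a b.
Proof.
move=> xa yb.
have yx : (y k - x k) @[k --> \oo] --> b - a by exact: cvgB.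
rewrite {2}/invgap; have [ab|ba] := ltP a b.
  apply: (@cvg_trans _ ((y k - x k)^-1%:E @[k --> \oo])).
    apply: near_eq_cvg; near=> k; rewrite /invgap ifT// -subr_gt0.
    by near: k; apply: (cvgr_gt (b - a)) => //; rewrite subr_gt0.
  apply: cvg_EFin; first exact: nearW.
  by apply: cvgV => //; rewrite gt_eqF// subr_gt0.
apply/cvgeyPge => A.
have A0 : 0 < (Num.max A 1)^-1 by rewrite invr_gt0 lt_max ltr01 orbT.
near=> k; rewrite /invgap; case: ifPn; last by rewrite leey.
rewrite -subr_gt0 lee_fin => xyk.
have : y k - x k < (Num.max A 1)^-1.
  near: k; apply: (cvgr_lt (b - a)) => //.
  by apply: le_lt_trans A0; rewrite subr_le0.
rewrite -ltf_pV2 ?posrE// invrK => /ltW; apply: le_trans.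
by rewrite le_max lexx.
Unshelve. all: by end_near. Qed.

Lemma bounded_seq_range (u : R^nat) a b : (forall k, a <= u k <= b) ->
  has_ubound (range u) /\ has_lbound (range u).
Proof.
move=> ab; split; [exists b|exists a] => _ [k _ <-];
  by have /andP[] := ab k.
Qed.

(** Taking limits superior defines the limit curve at every parameter; this inequality is the form
    in which the density bound passes to it. *)
Lemma limn_sup_shift (u v : R^nat) a b c :
  (forall k, a <= u k <= b) -> (forall k, a <= v k <= b) ->
  (forall k, u k + c <= v k) -> limn_sup u + c <= limn_sup v.
Proof.
move=> uab vab uv.
have [ubu lbu] := bounded_seq_range uab.
have [ubv lbv] := bounded_seq_range vab.
have cu := cvg_sups_inf ubu lbu; have cv := cvg_sups_inf ubv lbv.
rewrite -lerBrDr.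
have cvc : (sups v k - c) @[k --> \oo] --> limn_sup v - c.
  by apply: cvgB; [rewrite /limn_sup; apply/cvgP: cv|exact: cvg_cst].
rewrite -(cvg_lim _ cvc)//; apply: ler_lim.
- by apply/cvg_ex; eexists; exact: cu.
- by apply/cvg_ex; eexists; exact: cvc.
apply: nearW => k; apply: ge_sup; first by exists (u k), k => /=.
move=> _ [j /= kj <-]; rewrite lerBrDr; apply: le_trans (uv j) _.
by apply: ub_le_sup; [exact: has_ubound_sdrop|exists j].
Qed.

Lemma limn_sup_bounds (u : R^nat) a b : (forall k, a <= u k <= b) ->
  a <= limn_sup u <= b.
Proof.
move=> uab.
have ab : a <= b by have /andP[] := uab 0%N; exact: le_trans.
have limc c : limn_sup (cst c : R^nat) = c.
  by have [_ ->] := cvg_limn_inf_sup (cvg_cst c : cst c @ \oo --> (c : R)).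
apply/andP; split.
- rewrite -[leLHS]addr0 -(limc a); apply: (limn_sup_shift (a := a) (b := b)) => // k.
    by rewrite /= lexx.
  by rewrite addr0; have /andP[] := uab k.
- rewrite -[leLHS]addr0 -[leRHS](limc b); apply: (limn_sup_shift (a := a) (b := b)) => // k.
    by rewrite /= lexx andbT.
  by rewrite addr0; have /andP[] := uab k.
Qed.

Lemma cvg_bounded_variation (u : R^nat) M :
  (forall N, \sum_(0 <= k < N) `|u k.+1 - u k| <= M) -> cvgn u.
Proof.
move=> uM.
have cs : cvgn (series (telescope u)).
  apply: (@normed_cvg R R^o); apply: nondecreasing_is_cvgn.
    by apply: nondecreasing_series => k _ _; exact: normr_ge0.
  by exists M => _ [N _ <-]; exact: uM.
have -> : u = (fun k => u 0%N + series (telescope u) k).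
  by apply/funext => k; rewrite -eq_sum_telescope.
by apply: is_cvgD => //; exact: is_cvg_cst.
Qed.

(** The integral of the series is at most 2 C, so the series is finite almost everywhere. *)
Lemma ae_summable d (T : measurableType d) (mu : {measure set T -> \bar R})
    (f : nat -> T -> R) (C : R) :
  (forall k, measurable_fun setT (f k)) -> (forall k x, 0 <= f k x) ->
  (forall k, (\int[mu]_x (f k x)%:E <= (C / 2 ^+ k)%:E)%E) ->
  {ae mu, forall x, exists M, forall N, \sum_(0 <= k < N) f k x <= M}.
Proof.
move=> mf f0 fC.
pose g x := (\sum_(k <oo) (f k x)%:E)%E.
have g0 x : (0 <= g x)%E by apply: nneseries_ge0 => k _ _; rewrite lee_fin.
have mfE k : measurable_fun setT (fun x => (f k x)%:E) by exact/measurable_EFinP.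
have mg : measurable_fun setT g.
  by apply: ge0_emeasurable_sum => // k x _ _; rewrite lee_fin.
have gfin : (\int[mu]_x g x < +oo)%E.
  rewrite /g integral_nneseries//; last by move=> k x _; rewrite lee_fin.
  apply: (@le_lt_trans _ _ (C * 2)%:E); last by rewrite ltry.
  have C0 : 0 <= C.
    have := fC 0%N; rewrite expr0 divr1 -lee_fin; apply: le_trans.
    by apply: integral_ge0 => x _; rewrite lee_fin.
  apply: lime_le.
    by apply: is_cvg_nneseries => k _ _; apply: integral_ge0 => x _; rewrite lee_fin.
  apply: nearW => N.
  apply: (@le_trans _ _ (\sum_(0 <= k < N) (C / 2 ^+ k)%:E)%E).
    by apply: lee_sum => k _; exact: fC.
  rewrite sumEFin lee_fin -mulr_sumr ler_wpM2l//.
  suff -> : \sum_(0 <= k < N) (2 ^+ k)^-1 = 2 - 2 / 2 ^+ N :> R.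
    by rewrite gerBl divr_ge0// exprn_ge0.
  elim: N => [|N IH]; first by rewrite big_nil expr0 divr1 subrr.
  rewrite big_nat_recr//= IH exprS; field.
  by rewrite expf_neq0.
have gint : mu.-integrable setT g.
  apply/integrableP; split => //.
  by under eq_integral do rewrite gee0_abs//.
apply: filterS (integrable_ae measurableT gint) => x /(_ I) gx.
exists (fine (g x)) => N; rewrite -lee_fin fineK// -sumEFin.
by apply: nneseries_lim_ge => k _ _; rewrite lee_fin.
Qed.

End limits.

(** * Controlling times by gaps *)

Section coordinates.
Context {R : realType} (n : nat).
Implicit Types (s t : times R n).

Lemma time_gap (l : 'I_n.+2) t :
  time l t = time ord0 t + \sum_(e < n.+1 | (e < l)%N) gap e t.
Proof.
case: l => l ln; elim: l ln => [|l IH] ln.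
  by rewrite big_pred0// addr0; congr (tnth _ _); exact/val_inj.
have ln1 : (l < n.+1)%N by [].
have ln2 : (l < n.+2)%N by exact: ltnW.
rewrite (bigD1 (Ordinal ln1)) //=.
rewrite (eq_bigl (fun e : 'I_n.+1 => (e < l)%N)); last first.
  by move=> e; rewrite ltnS -val_eqE/= [RHS]ltn_neqAle andbC.
rewrite addrCA -(IH ln2) /gap.
have -> : edge_dst (Ordinal ln1) = Ordinal ln :> 'I_n.+2 by exact/val_inj.
have -> : edge_src (Ordinal ln1) = Ordinal ln2 :> 'I_n.+2 by exact/val_inj.
by rewrite subrK.
Qed.

(** Young's inequality |x| <= c w x^2 + 1/(c w) on each edge, the initial times being equal. The
    free constant [c] trades the squared distance against the remainder. *)
Lemma time_dist_le (w : 'I_n.+2 -> 'I_n.+2 -> R) (l : 'I_n.+2) s t c : 0 < c ->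
  (forall e : 'I_n.+1, 0 < w (edge_src e) (edge_dst e)) ->
  time ord0 s = time ord0 t ->
  `|time l s - time l t| <= c * gap_dist w s t +
    (\sum_(e < n.+1) (w (edge_src e) (edge_dst e))^-1) / c.
Proof.
move=> c0 w0 st0; rewrite (time_gap l s) (time_gap l t) st0.
rewrite opprD addrACA subrr add0r -sumrB.
apply: le_trans (ler_norm_sum _ _ _) _.
rewrite [leLHS]big_mkcond/= /gap_dist mulr_sumr mulr_suml -big_split/=.
apply: ler_sum => e _; have := w0 e; set we := w _ _ => we0.
set x := _ - gap e t.
have h : `|x| <= c * (we * x ^+ 2) + we^-1 / c.
  have cw : 0 < c * we by rewrite mulr_gt0.
  have -> : we^-1 / c = (c * we)^-1 by rewrite invfM mulrC.
  rewrite mulrA (_ : x ^+ 2 = `|x| ^+ 2); last by rewrite real_normK ?num_real.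
  move: (c * we) cw (`|x|) => k k0 z.
  (* Expanding this square gives z <= k z^2 + 1/(4 k). *)
  have : 0 <= k * (z - k^-1 / 2) ^+ 2 by rewrite mulr_ge0 ?sqr_ge0// ltW.
  have -> : k * (z - k^-1 / 2) ^+ 2 = k * z ^+ 2 + k^-1 / 4 - z.
    by field; rewrite gt_eqF.
  have : 0 < k^-1 by rewrite invr_gt0.
  lra.
by case: ifP => // _; apply: le_trans h.
Qed.

End coordinates.

(** * Minimization over quantile curves *)

Section reduced_problem.
Context {R : realType} (n : nat).
Variables (tf : R) (w : 'I_n.+2 -> 'I_n.+2 -> R) (r : 'I_n.+2 -> R).
Hypothesis tf0 : 0 < tf.
Hypothesis w0 : forall e : 'I_n.+1, 0 < w (edge_src e) (edge_dst e).
Variables q0 qT : R -> R.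
Implicit Types S T : measurableTypeR R -> times R n.

(* The last clause says that the law of [time l (T u)], for [u] uniform, has
   density at most [r l]. *)
Definition admissible T :=
  [/\ forall l, measurable_fun setT (fun u => time l (T u) : measurableTypeR R),
      forall u, time_cube tf (T u),
      forall u, time ord0 (T u) = q0 u,
      forall u, time ord_max (T u) = qT u
    & forall l : 'I_n.+2, (0 < l < n.+1)%N -> forall u v : R,
        0 < u -> u < v -> v <= 1 ->
        v - u <= r l * (time l (T v) - time l (T u)) ].

Definition energy T : \bar R := (\int[unif]_u path_cost w (T u))%E.

Lemma admissible_measurable T : admissible T -> measurable_fun setT T.
Proof. by move=> [mT _ _ _ _]; apply/measurable_fun_tnthP => l; exact: mT. Qed.

Lemma measurable_path_cost_comp T : admissible T ->
  measurable_fun setT (fun u => path_cost w (T u)).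
Proof.
move=> /admissible_measurable mT.
exact: (measurableT_comp (measurable_path_cost w0) mT).
Qed.

Lemma energy_ge0 T : (0 <= energy T)%E.
Proof. by apply: integral_ge0 => u _; exact: path_cost_ge0. Qed.

Lemma admissible_midpoint S T : admissible S -> admissible T ->
  admissible (fun u => midpoint (S u) (T u)).
Proof.
move=> [mS cS S0 ST Sr] [mT cT T0 TT Tr]; split.
- move=> l; under eq_fun do rewrite time_midpoint.
  by apply: measurable_funM => //; apply: measurable_funD; [exact: mS|exact: mT].
- move=> u l; rewrite time_midpoint.
  by have /andP[? ?] := cS u l; have /andP[? ?] := cT u l; apply/andP; split; lra.
- by move=> u; rewrite time_midpoint S0 T0; lra.
- by move=> u; rewrite time_midpoint ST TT; lra.
- move=> l hl u v u0 uv v1; rewrite !time_midpoint.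
  have := Sr l hl u v u0 uv v1; have := Tr l hl u v u0 uv v1; lra.
Qed.

Lemma measurable_gap_dist S T : admissible S -> admissible T ->
  measurable_fun setT (fun u => gap_dist w (S u) (T u)).
Proof.
move=> [mS _ _ _ _] [mT _ _ _ _]; apply: measurable_sum => e.
apply: measurable_funM => //; apply: measurable_funX; rewrite /gap.
by apply: measurable_funB; apply: measurable_funB; first [exact: mS|exact: mT].
Qed.

Lemma energy_midpoint S T : admissible S -> admissible T ->
  (2%:E * energy (fun u => midpoint (S u) (T u)) +
   (2 * tf ^+ 3)^-1%:E * \int[unif]_u (gap_dist w (S u) (T u))%:E <=
   energy S + energy T)%E.
Proof.
move=> aS aT; have aM := admissible_midpoint aS aT.
have k0 : 0 <= (2 * tf ^+ 3)^-1 by rewrite invr_ge0 mulr_ge0// exprn_ge0// ltW.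
have mg : measurable_fun setT (fun u => (gap_dist w (S u) (T u))%:E).
  by apply/measurable_EFinP; exact: measurable_gap_dist.
have pc0 t : (0 <= path_cost w t)%E by exact: path_cost_ge0.
have mS := measurable_path_cost_comp aS; have mT := measurable_path_cost_comp aT.
have mM := measurable_path_cost_comp aM.
rewrite /energy -ge0_integralZl//.
rewrite -ge0_integralZl//; last by move=> u _; rewrite lee_fin gap_dist_ge0.
rewrite -!ge0_integralD//; first last.
- by apply: emeasurable_funM => //; exact: measurable_cst.
- by move=> u _; rewrite mule_ge0// lee_fin gap_dist_ge0.
- by apply: emeasurable_funM => //; exact: measurable_cst.
- by move=> u _; rewrite mule_ge0.
apply: ge0_le_integral => //.
- move=> u _; rewrite adde_ge0// mule_ge0// lee_fin gap_dist_ge0//.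
- apply: emeasurable_funD; apply: emeasurable_funM => //; exact: measurable_cst.
- by apply: emeasurable_funD.
- move=> u _; rewrite -EFinM; apply: path_cost_midpoint => //.
    by case: aS.
  by case: aT.
Qed.

Let m := ereal_inf [set energy T | T in admissible].

(** The midpoint curve is admissible, so its energy is at least [m], and the slacks [a] and [b] must
    pay for the convexity defect. *)
Lemma gap_dist_near_minimal S T (a b : R) : admissible S -> admissible T ->
  m \is a fin_num ->
  (energy S <= m + a%:E)%E -> (energy T <= m + b%:E)%E ->
  (\int[unif]_u (gap_dist w (S u) (T u))%:E <= (2 * tf ^+ 3 * (a + b))%:E)%E.
Proof.
move=> aS aT mfin Sa Tb.
have k0 : 0 < 2 * tf ^+ 3 by rewrite mulr_gt0// exprn_gt0.
have mM : (m <= energy (fun u => midpoint (S u) (T u)))%E.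
  by apply: ereal_inf_lbound; exists (fun u => midpoint (S u) (T u)) => //;
    exact: admissible_midpoint.
have H := energy_midpoint aS aT.
set D := (\int[unif]_u _)%E in H *.
have D0 : (0 <= D)%E by apply: integral_ge0 => u _; rewrite lee_fin gap_dist_ge0.
have : ((2 * tf ^+ 3)^-1%:E * D <= (a + b)%:E)%E.
  have h1 : (2%:E * m + (2 * tf ^+ 3)^-1%:E * D <= m + a%:E + (m + b%:E))%E.
    apply: le_trans (leeD Sa Tb); apply: le_trans H.
    by rewrite leeD2r// lee_wpmul2l.
  move: h1; rewrite -(fineK mfin).
  move: ((2 * tf ^+ 3)^-1%:E * D)%E => [x| |]//=; last by move=> _; exact: leNye.
  by rewrite -!EFinM -!EFinD !lee_fin; lra.
move=> h; rewrite EFinM.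
have -> : D = ((2 * tf ^+ 3)%:E * ((2 * tf ^+ 3)^-1%:E * D))%E.
  by rewrite muleA -EFinM mulfV ?gt_eqF// mul1e.
by rewrite lee_wpmul2l// lee_fin ltW.
Qed.

(** With zero slack the gaps agree almost everywhere, and both curves have the initial coordinate
    [q0]. *)
Lemma minimal_unique S T : admissible S -> admissible T ->
  m \is a fin_num -> energy S = m -> energy T = m ->
  {ae unif, forall u, S u = T u}.
Proof.
move=> aS aT mfin Sm Tm.
have := @gap_dist_near_minimal S T 0 0 aS aT mfin.
rewrite !adde0 Sm Tm addr0 mulr0 => /(_ (lexx _) (lexx _)) D0.
have mg : measurable_fun setT (fun u => (gap_dist w (S u) (T u))%:E).
  by apply/measurable_EFinP; exact: measurable_gap_dist.
have : (\int[unif]_u `|(gap_dist w (S u) (T u))%:E| = 0)%E.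
  apply/eqP; rewrite eq_le integral_ge0// andbT.
  by under eq_integral do rewrite gee0_abs ?lee_fin ?gap_dist_ge0//.
move=> /(ae_eq_integral_abs _ measurableT mg).
have [_ _ S0 _ _] := aS; have [_ _ T0 _ _] := aT.
apply: (@filterS _ _ (ae_filter_ringOfSetsType unif)) => u /(_ I) [D0u].
apply: eq_from_tnth => l; apply/eqP; rewrite -subr_eq0 -normr_le0.
apply/ler_addgt0Pr => e e0; rewrite add0r.
pose W := \sum_(e < n.+1) (w (edge_src e) (edge_dst e))^-1.
have W0 : 0 <= W by apply: sumr_ge0 => i _; rewrite invr_ge0 ltW.
(* With this constant the remainder in [time_dist_le] is at most [e]. *)
have c0 : 0 < (W + 1) / e by rewrite divr_gt0// ltr_wpDl.
have := time_dist_le l c0 w0 (etrans (S0 u) (esym (T0 u))).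
rewrite D0u mulr0 add0r => /le_trans; apply.
rewrite -/W invf_div mulrCA ler_piMr ?(ltW e0)//.
by rewrite ler_pdivrMr ?mul1r ?lerDl// ltr_wpDl.
Qed.

End reduced_problem.

(** * Existence of a minimizing curve *)

Section existence.
Context {R : realType} (n : nat).
Variables (tf : R) (w : 'I_n.+2 -> 'I_n.+2 -> R) (r : 'I_n.+2 -> R).
Hypothesis tf0 : 0 < tf.
Hypothesis w0 : forall e : 'I_n.+1, 0 < w (edge_src e) (edge_dst e).
Hypothesis r0 : forall l : 'I_n.+2, (0 < l < n.+1)%N -> 0 < r l.
Variables q0 qT : R -> R.
Implicit Types T : measurableTypeR R -> times R n.

Local Notation adm := (admissible tf r q0 qT).
Let m := ereal_inf [set energy w T | T in adm].

Lemma minimal_fin_num : (exists2 T, adm T & (energy w T < +oo)%E) ->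
  m \is a fin_num.
Proof.
move=> [T aT finT]; rewrite ge0_fin_numE.
  by apply: le_lt_trans finT; apply: ereal_inf_lbound; exists T.
by apply: le_ereal_inf_tmp => _ [S _ <-]; exact: energy_ge0.
Qed.

Lemma admissible_limn_sup (T : nat -> measurableTypeR R -> times R n) :
  (forall k, adm (T k)) ->
  adm (fun u => [tuple limn_sup (fun k => time l (T k u)) | l < n.+2]).
Proof.
move=> aT.
have bT k u l : 0 <= time l (T k u) <= tf by have [_ cT _ _ _] := aT k; exact: cT.
have timeE u l : time l [tuple limn_sup (fun k => time l (T k u)) | l < n.+2] =
    limn_sup (fun k => time l (T k u)) by rewrite /time tnth_mktuple.
have limc (c : R) : limn_sup (cst c : R^nat) = c.
  by have [_ ->] := cvg_limn_inf_sup (cvg_cst c : cst c @ \oo --> (c : R)).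
split.
- move=> l; under eq_fun do rewrite timeE.
  apply: measurable_fun_limn_sup.
  + by move=> u _; have [] := bounded_seq_range (fun k => bT k u l).
  + by move=> u _; have [] := bounded_seq_range (fun k => bT k u l).
  + by move=> k; have [mT _ _ _ _] := aT k; exact: mT.
- by move=> u l; rewrite timeE; exact: limn_sup_bounds.
- move=> u; rewrite timeE -[RHS]limc; congr limn_sup.
  by apply/funext => k; have [_ _ -> _ _] := aT k.
- move=> u; rewrite timeE -[RHS]limc; congr limn_sup.
  by apply/funext => k; have [_ _ _ -> _] := aT k.
(* Dividing by [r l] puts the density bound in the form of [limn_sup_shift]. *)
- move=> l hl u v u0 uv v1; rewrite !timeE mulrC -ler_pdivrMr ?r0// lerBrDl.
  apply: (limn_sup_shift (a := 0) (b := tf)) => // k.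
  have [_ _ _ _ Tr] := aT k; have := Tr l hl u v u0 uv v1.
  by rewrite mulrC -ler_pdivrMr ?r0// lerBrDl.
Qed.

Lemma minimal_exists : (exists2 T, adm T & (energy w T < +oo)%E) ->
  exists2 T, adm T & energy w T = m.
Proof.
move=> exT; have mfin := minimal_fin_num exT.
have K0 : 0 < 2 * tf ^+ 3 by rewrite mulr_gt0// exprn_gt0.
(* This is 4^-k, so that the squared distance of consecutive curves, multiplied by 2^k, still has an
   integral of order 2^-k. *)
pose eps k : R := (2 ^+ k)^-1 / (2 ^+ k).
have pow0 k : 0 < (2 ^+ k)^-1 :> R by rewrite invr_gt0 exprn_gt0.
have eps0 k : 0 < eps k by rewrite divr_gt0// exprn_gt0.
have /choice[T Tk] : forall k, exists T, adm T /\ (energy w T <= m + (eps k)%:E)%E.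
  move=> k; have [_ [T aT <-] Tm] := lb_ereal_inf_adherent (eps0 k) mfin.
  by exists T; split => //; exact: ltW.
have aT k : adm (T k) by have [] := Tk k.
have Tm k : (energy w (T k) <= m + (eps k)%:E)%E by have [] := Tk k.
exists (fun u => [tuple limn_sup (fun k => time l (T k u)) | l < n.+2]).
  exact: admissible_limn_sup.
have aL := admissible_limn_sup aT.
set L := (fun u => _) in aL *.
pose f k u : R := 2 ^+ k * gap_dist w (T k u) (T k.+1 u).
have f0 k u : 0 <= f k u by rewrite mulr_ge0 ?exprn_ge0// gap_dist_ge0.
have mgd k : measurable_fun setT (fun u => gap_dist w (T k u) (T k.+1 u)).
  exact: measurable_gap_dist.
have mf k : measurable_fun setT (f k) by apply: measurable_funM.
have fC k : (\int[unif]_u (f k u)%:E <= (2 * tf ^+ 3 * 2 / 2 ^+ k)%:E)%E.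
  under eq_integral do rewrite EFinM.
  rewrite ge0_integralZl//; last 2 first.
  - by apply/measurable_EFinP.
  - by move=> u _; rewrite lee_fin gap_dist_ge0.
  have := gap_dist_near_minimal tf0 w0 (aT k) (aT k.+1) mfin (Tm k) (Tm k.+1).
  move=> /(lee_wpmul2l (_ : 0 <= (2 ^+ k)%:E)%E) => /(_ _)/le_trans; apply.
    by rewrite lee_fin exprn_ge0.
  rewrite -EFinM lee_fin.
  have -> : 2 * tf ^+ 3 * 2 / 2 ^+ k = 2 ^+ k * (2 * tf ^+ 3 * (2 * eps k)).
    by rewrite /eps; field; rewrite expf_neq0.
  rewrite ler_pM2l ?exprn_gt0// ler_pM2l// mulr2n mulrDl mul1r lerD2l.
  rewrite /eps ler_pM ?invr_ge0 ?exprn_ge0//; rewrite lef_pV2 ?posrE ?exprn_gt0//;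
    by rewrite exprS ler_peMl ?exprn_ge0// ler1n.
(* By [time_dist_le] with c = 2^k, consecutive curves differ at each node by at most
   [f k u + W / 2 ^+ k], which is summable in [k] for almost every [u]. *)
have cvgT : {ae unif, forall u, forall l, time l (T k u) @[k --> \oo] --> time l (L u)}.
  have := ae_summable mf f0 fC.
  apply: (@filterS _ _ (ae_filter_ringOfSetsType unif)) => u [M fM] l.
  pose W := \sum_(e < n.+1) (w (edge_src e) (edge_dst e))^-1.
  have W0 : 0 <= W by apply: sumr_ge0 => i _; rewrite invr_ge0 ltW.
  have geo N : \sum_(0 <= k < N) (2 ^+ k)^-1 = 2 - 2 / 2 ^+ N :> R.
    elim: N => [|N IH]; first by rewrite big_nil expr0 divr1 subrr.
    by rewrite big_nat_recr//= IH exprS; field; rewrite expf_neq0.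
  have cu : cvgn (fun k => time l (T k u)).
    apply: (@cvg_bounded_variation _ _ (M + W * 2)) => N.
    apply: (@le_trans _ _ (\sum_(0 <= k < N) (f k u + W * (2 ^+ k)^-1))).
      apply: ler_sum => k _; rewrite distrC.
      apply: (@time_dist_le _ _ w l _ _ (2 ^+ k)) => //.
      by have [_ _ -> _ _] := aT k; have [_ _ -> _ _] := aT k.+1.
    rewrite big_split/= lerD// -mulr_sumr ler_wpM2l// geo gerBl.
    by rewrite divr_ge0// exprn_ge0.
  rewrite /L /time tnth_mktuple.
  by have [_ ->] := cvg_limn_inf_sup cu; exact: cu.
have pc0 t : (0 <= path_cost w t)%E by exact: path_cost_ge0.
have mpc k := measurable_path_cost_comp w0 (aT k).
apply/eqP; rewrite eq_le; apply/andP; split; last first.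
  by apply: ereal_inf_lbound; exists L.
have cvgE : energy w (T k) @[k --> \oo] --> m.
  apply: (@squeeze_cvge _ _ _ _ (cst m) _ (fun k => m + (eps k)%:E)%E).
  - apply: nearW => k; rewrite Tm andbT; apply: ereal_inf_lbound.
    by exists (T k).
  - exact: cvg_cst.
  - rewrite -[X in _ --> X]adde0; apply: cvgeD.
    + by rewrite fin_num_adde_defr.
    + exact: cvg_cst.
    + apply: cvg_EFin; first exact: nearW.
      rewrite -[X in _ --> X](mulr0 (0 : R)).
      have c2 : ((2 ^+ k)^-1 : R) @[k --> \oo] --> 0.
        under eq_fun do rewrite -exprVn.
        by apply: cvg_expr; rewrite ger0_norm ?invr_ge0// invf_lt1// ltr1n.
      by apply: cvgM.
(* Fatou's lemma bounds the energy of the limit curve by the limit [m] of the energies. *)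
have [<- _] := cvg_limn_einf_sup cvgE.
apply: le_trans (fatou unif measurableT mpc (fun k u _ => pc0 _)).
apply: ae_ge0_le_integral => //.
- exact: measurable_path_cost_comp aL.
- move=> u _; rewrite limn_einf_lim; apply: lime_ge; first exact: is_cvg_einfs.
  by apply: nearW => k; apply: le_ereal_inf_tmp => _ [j _ <-].
- apply: (emeasurable_fun_cvg (fun k u => einfs (fun j => path_cost w (T j u)) k)).
    by move=> k; exact: measurable_fun_einfs.
  by move=> u _; rewrite limn_einf_lim; exact: is_cvg_einfs.
apply: (@filterS _ _ (ae_filter_ringOfSetsType unif)) cvgT => u cu _.
(* The path cost converges edge by edge, also where a gap closes in the limit. *)
suff : path_cost w (T k u) @[k --> \oo] --> path_cost w (L u).
  by move/cvg_limn_einf_sup => [-> _].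
under eq_fun do rewrite (path_costE w0).
rewrite (path_costE w0).
apply: cvg_nnesum => e _.
  by apply: nearW => k; rewrite mule_ge0 ?invgap_ge0// lee_fin ltW.
by apply: cvgeZl => //; apply: cvg_invgap; exact: cu.
Qed.

End existence.

(** * Transport plans and quantile curves *)

Section plans.
Context {R : realType} (n : nat).
Variables (tf : R) (w : 'I_n.+2 -> 'I_n.+2 -> R) (r : 'I_n.+2 -> R).
Hypothesis tf0 : 0 < tf.
Hypothesis w0 : forall e : 'I_n.+1, 0 < w (edge_src e) (edge_dst e).
Hypothesis r0 : forall l : 'I_n.+2, (0 < l < n.+1)%N -> 0 < r l.
Variables mu0 muT : probability (measurableTypeR R) R.

Definition marginal_quantile (mu : probability (measurableTypeR R) R) : R -> R :=
  quantile (dist_fun mu idfun).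

Local Notation adm :=
  (admissible tf r (marginal_quantile mu0) (marginal_quantile muT)).

Lemma is_cdf_idfun (mu : probability (measurableTypeR R) R) :
  mu `[0, tf]%classic = 1%E -> is_cdf tf (dist_fun mu idfun).
Proof.
move=> mu1; apply: is_cdf_dist_fun; first exact: measurable_id.
rewrite (_ : [set t | _] = ~` `[0, tf]%classic).
  by rewrite probability_setC// [X in (1 - X)%E]mu1 subee.
by apply/seteqP; split => t /=; rewrite in_itv/= => /negP.
Qed.

Lemma law_marginal_quantile (mu : probability (measurableTypeR R) R) :
  mu `[0, tf]%classic = 1%E -> forall A, measurable A ->
  unif (marginal_quantile mu @^-1` A) = mu A.
Proof.
move=> mu1 A mA.
exact: (law_quantile tf0 (@measurable_id _ _ setT) (is_cdf_idfun mu1) mA).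
Qed.

Definition mfun_of (T : measurableTypeR R -> times R n)
    (mT : measurable_fun setT T) : {mfun measurableTypeR R >-> times R n} :=
  HB.pack T (isMeasurableFun.Build _ _ _ _ T mT).

Definition image_plan (T : measurableTypeR R -> times R n)
    (mT : measurable_fun setT T) : probability (times R n) R :=
  distribution unif (mfun_of mT).

Lemma transport_plan_image (T : measurableTypeR R -> times R n)
    (mT : measurable_fun setT T) :
  mu0 `[0, tf]%classic = 1%E -> muT `[0, tf]%classic = 1%E ->
  adm T -> transport_plan tf mu0 muT r (image_plan mT).
Proof.
move=> mu01 muT1 [mTl cT T0 TT Tr]; split.
- rewrite /on_cube; change (unif (T @^-1` (~` time_cube tf)) = 0%E).
  rewrite (_ : T @^-1` _ = set0) ?measure0//.
  by apply/seteqP; split => // u /=; apply; exact: cT.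
- move=> A mA; rewrite -(law_marginal_quantile mu01 mA).
  change (unif (T @^-1` (time ord0 @^-1` A)) = unif (marginal_quantile mu0 @^-1` A)).
  by congr (unif _); apply/seteqP; split => u /=; rewrite /= T0.
- move=> A mA; rewrite -(law_marginal_quantile muT1 mA).
  change (unif (T @^-1` (time ord_max @^-1` A)) = unif (marginal_quantile muT @^-1` A)).
  by congr (unif _); apply/seteqP; split => u /=; rewrite /= TT.
- move=> l hl A mA.
  change (unif ((fun u => time l (T u)) @^-1` A) <= (r l)%:E * lebesgue_measure A)%E.
  apply: (expand_law_le (mTl l)) => //; first exact: r0.
  exact: Tr.
Qed.

Lemma total_cost_image (T : measurableTypeR R -> times R n)
    (mT : measurable_fun setT T) :
  total_cost w (image_plan mT) = energy w T.
Proof.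
rewrite /total_cost /energy /image_plan ge0_integral_distribution//.
- exact: measurable_path_cost.
- by move=> t; exact: path_cost_ge0.
Qed.

(** A plan is an arbitrary nonnegative measure, but its marginal at node 0 fixes its mass. *)
Lemma transport_plan_setT (pi : {measure set (times R n) -> \bar R}) :
  transport_plan tf mu0 muT r pi -> pi setT = 1%E.
Proof.
move=> [_ /(_ setT measurableT) + _ _].
by rewrite /marginal /pushforward preimage_setT probability_setT.
Qed.

End plans.

(** * The quantile curve of a plan *)

Section quantile_map.
Context {R : realType} (n : nat).
Variables (tf : R) (w : 'I_n.+2 -> 'I_n.+2 -> R) (r : 'I_n.+2 -> R).
Hypothesis tf0 : 0 < tf.
Hypothesis w0 : forall e : 'I_n.+1, 0 < w (edge_src e) (edge_dst e).
Hypothesis r0 : forall l : 'I_n.+2, (0 < l < n.+1)%N -> 0 < r l.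
Variables mu0 muT : probability (measurableTypeR R) R.
Variable P : probability (times R n) R.
Hypothesis plan : transport_plan tf mu0 muT r P.

Let X (l : 'I_n.+2) : times R n -> measurableTypeR R := time l.
Let F l := dist_fun P (X l).
Let mX l : measurable_fun setT (X l) := measurable_time l.

Definition quantile_map : measurableTypeR R -> times R n :=
  fun u => [tuple quantile (F l) u | l < n.+2].

Lemma time_quantile_map l u : time l (quantile_map u) = quantile (F l) u.
Proof. by rewrite /time tnth_mktuple. Qed.

Lemma is_cdf_marginal l : is_cdf tf (F l).
Proof.
apply: is_cdf_dist_fun; first exact: mX.
have [Pc _ _ _] := plan.
apply: (subset_measure0 (B := ~` time_cube tf)) => //.
- apply: measurable_bool_set; apply: measurable_neg.
  by apply: measurable_and; apply: measurable_fun_ler => //; exact: mX.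
- apply: measurableC; rewrite (_ : time_cube tf =
      \bigcap_(l : 'I_n.+2) [set t | 0 <= time l t <= tf]).
    apply: fin_bigcap_measurable => // l' _; apply: measurable_bool_set.
    by apply: measurable_and; apply: measurable_fun_ler => //; exact: mX.
  by apply/seteqP; split => [t h l' _|t h l']; [exact: h|exact: (h l' I)].
- by move=> t /= /negP tl ct; apply: tl; exact: ct.
Qed.

Lemma marginal_lipschitz (l : 'I_n.+2) a b : (0 < l < n.+1)%N -> a <= b ->
  F l b - F l a <= r l * (b - a).
Proof.
move=> hl ab; have [_ _ _ /(_ l hl `]a, b]%classic (measurable_itv _))] := plan.
rewrite lebesgue_measure_itv/= lte_fin => H.
have mA := measurable_le_fun (mX l) a; have mB := measurable_le_fun (mX l) b.
have mM : measurable (X l @^-1` `]a, b]%classic).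
  by rewrite -[X in measurable X]setTI; exact: mX.
have FE : F l b = F l a + fine (P (X l @^-1` `]a, b]%classic)).
  apply: EFin_inj; rewrite EFinD /F !(dist_funE _ (mX l)) fineK ?fin_num_measure//.
  rewrite -measureU//.
    congr (P _); apply/seteqP; split => t /=; rewrite in_itv/=.
      by move=> h; case: (leP (X l t) a) => h'; [left|right].
    by move=> [/le_trans|/andP[]//]; exact.
  apply/seteqP; split => t //= [h]; rewrite in_itv/= => /andP[].
  by rewrite ltNge h.
rewrite FE addrAC subrr add0r -lee_fin fineK ?fin_num_measure//.
apply: le_trans H _; case: ifPn => [_|]; first by rewrite -EFinB -EFinM.
by rewrite -leNgt => ba; rewrite mule0 lee_fin mulr_ge0 ?subr_ge0// ltW// r0.
Qed.

(** The end coordinates depend only on [mu0] and [muT], so the curves of all plans compete in one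
    class. *)
Lemma admissible_quantile_map :
  admissible tf r (marginal_quantile mu0) (marginal_quantile muT) quantile_map.
Proof.
have [_ P0 PT _] := plan.
have E l (mu : probability (measurableTypeR R) R) :
    (forall A, measurable A -> marginal P l A = mu A) -> F l = dist_fun mu idfun.
  move=> Pmu; apply/funext => z; rewrite /F /dist_fun; congr fine.
  exact: (Pmu [set t | t <= z] (measurable_le_fun (@measurable_id _ _ setT) z)).
split.
- move=> l; under eq_fun do rewrite time_quantile_map.
  exact: measurable_quantile tf0 (is_cdf_marginal l).
- move=> u l; rewrite time_quantile_map.
  exact: quantile_bounds (is_cdf_marginal l).
- by move=> u; rewrite time_quantile_map (E _ _ P0).
- by move=> u; rewrite time_quantile_map (E _ _ PT).
- move=> l hl u v u0 uv v1; rewrite !time_quantile_map.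
  apply: (quantile_expand tf0 (is_cdf_marginal l)) => //; first exact: r0.
  by move=> a b; exact: marginal_lipschitz.
Qed.

Lemma integral_path_costE d (S : measurableType d) (Q : probability S R)
    (T : S -> times R n) : measurable_fun setT T ->
  (\int[Q]_s path_cost w (T s) = \sum_(e < n.+1) (w (edge_src e) (edge_dst e))%:E *
     \int[Q]_s invgap (time (edge_src e) (T s)) (time (edge_dst e) (T s)))%E.
Proof.
move=> mT.
have mi (e : 'I_n.+1) : measurable_fun setT
    (fun s => invgap (time (edge_src e) (T s)) (time (edge_dst e) (T s))).
  apply: measurable_invgap; apply: (measurableT_comp _ mT); exact: measurable_time.
under eq_integral do rewrite (path_costE w0).
rewrite ge0_integral_sum//.
- apply: eq_bigr => e _; rewrite ge0_integralZl//; last by rewrite lee_fin ltW.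
  by move=> s _; exact: invgap_ge0.
- by move=> e; apply: emeasurable_funM.
- by move=> e s _; rewrite mule_ge0 ?invgap_ge0// lee_fin ltW.
Qed.

(** The cost is a sum over edges, and the single quantile curve gives the monotone coupling on all
    edges at once. *)
Lemma energy_quantile_map_le : (energy w quantile_map <= total_cost w P)%E.
Proof.
rewrite /energy /total_cost.
rewrite integral_path_costE; last exact: admissible_measurable admissible_quantile_map.
rewrite (integral_path_costE P (@measurable_id _ _ setT)).
apply: lee_sum => e _; apply: lee_wpmul2l; first by rewrite lee_fin ltW.
under eq_integral do rewrite !time_quantile_map.
exact: quantile_invgap_le (is_cdf_marginal _) (is_cdf_marginal _).
Qed.

(** No edge costs less than its quantile pair, so with a finite total no edge can cost more without
    making the whole plan worse than the curve. *)
Lemma optimal_edge : (total_cost w P <= energy w quantile_map)%E ->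
  (total_cost w P < +oo)%E -> forall e : 'I_n.+1,
  (\int[P]_t invgap (X (edge_src e) t) (X (edge_dst e) t) < +oo)%E /\
  (\int[P]_t invgap (X (edge_src e) t) (X (edge_dst e) t) <=
   \int[unif]_u invgap (quantile (F (edge_src e)) u) (quantile (F (edge_dst e)) u))%E.
Proof.
rewrite /energy /total_cost.
rewrite integral_path_costE; last exact: admissible_measurable admissible_quantile_map.
rewrite (integral_path_costE P (@measurable_id _ _ setT)).
under [X in (_ <= X)%E -> _]eq_bigr do
  under eq_integral do rewrite !time_quantile_map.
pose we e := w (edge_src e) (edge_dst e).
pose A e := (\int[P]_t invgap (X (edge_src e) t) (X (edge_dst e) t))%E.
pose B e := (\int[unif]_u invgap (quantile (F (edge_src e)) u) (quantile (F (edge_dst e)) u))%E.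
rewrite -/(\sum_(e < n.+1) (we e)%:E * A e)%E -/(\sum_(e < n.+1) (we e)%:E * B e)%E.
move=> AB Afin e; rewrite -/(A e) -/(B e).
have we0 e' : (0 <= (we e')%:E)%E by rewrite lee_fin ltW// w0.
have A0 e' : (0 <= A e')%E by apply: integral_ge0 => t _; exact: invgap_ge0.
have BA e' : (B e' <= A e')%E.
  exact: quantile_invgap_le (is_cdf_marginal _) (is_cdf_marginal _).
have := Afin; rewrite (bigD1 e)//= => Afin'.
(* Finiteness of the other terms allows them to be cancelled from the comparison of sums. *)
have restfin : (\sum_(i < n.+1 | i != e) (we i)%:E * A i)%E \is a fin_num.
  rewrite ge0_fin_numE; last by apply: sume_ge0 => i _; rewrite mule_ge0.
  by apply: le_lt_trans Afin'; rewrite leeDr// mule_ge0.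
have Aefin : (A e < +oo)%E.
  rewrite -(@lte_pmul2l _ (we e)%:E) ?lte_fin ?w0// gt0_muley ?lte_fin ?w0//.
  by apply: le_lt_trans Afin'; rewrite leeDl// sume_ge0// => i _; rewrite mule_ge0.
split => //.
rewrite -(@lee_pmul2l _ (we e)%:E) ?lte_fin ?w0// -(leeD2rE _ _ restfin).
move: AB; rewrite (bigD1 e)//= [leRHS](bigD1 e)//= => /le_trans; apply.
by rewrite leeD2l// lee_sum// => i _; rewrite lee_wpmul2l.
Qed.

End quantile_map.

Section comonotone.
Context {R : realType}.

(** A Lipschitz distribution function has no jumps, so the level [c] is hit exactly. *)
Lemma dist_fun_quantileK tf (F : R -> R) r c : 0 < tf -> is_cdf tf F -> 0 < r ->
  (forall a b, a <= b -> F b - F a <= r * (b - a)) ->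
  0 < c <= 1 -> F (quantile F c) = c.
Proof.
move=> tf0 cF r0 lipF c01.
have cFc : c <= F (quantile F c) by rewrite -(quantile_le _ tf0 cF c01).
apply/eqP; rewrite eq_le cFc andbT.
apply/ler_addgt0Pr => e e0.
have er0 : 0 < e / r by rewrite divr_gt0.
have Fu : F (quantile F c - e / r) < c.
  by rewrite ltNge -(quantile_le _ tf0 cF c01) -ltNge ltrBlDr ltrDl.
have := lipF (quantile F c - e / r) (quantile F c) ltac:(lra).
have -> : r * (quantile F c - (quantile F c - e / r)) = e by field; rewrite gt_eqF.
lra.
Qed.

Lemma measurable_dist_fun tf (F : R -> R) : is_cdf tf F ->
  measurable_fun setT (F : measurableTypeR R -> measurableTypeR R).
Proof. by move=> [ndF _ _ _]; exact: nondecreasing_measurable. Qed.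

Lemma ae_eq_subset d (T : measurableType d) (P : probability T R) (A B : set T) :
  measurable A -> measurable B -> A `<=` B -> P A = P B ->
  {ae P, forall t, A t <-> B t}.
Proof.
move=> mA mB AB PAB; exists (B `\` A); split.
- exact: measurableD.
- rewrite measureD ?setIidr//; last by rewrite (le_lt_trans (probability_le1 _ _)) ?ltry.
  by rewrite [X in (_ - X)%E]PAB subee// fin_num_measure.
- move=> t /= h; have [tA|tA] := pselect (A t).
    by exfalso; apply: h; split => // _; exact: AB.
  by split => //; apply: contrapT => tB; apply: h; split.
Qed.

End comonotone.

(** * Optimal plans are laws of their quantile curves *)

Section rigidity.
Context {R : realType} (n : nat).
Variables (tf : R) (w : 'I_n.+2 -> 'I_n.+2 -> R) (r : 'I_n.+2 -> R).
Hypothesis tf0 : 0 < tf.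
Hypothesis n1 : (1 <= n)%N.
Hypothesis w0 : forall e : 'I_n.+1, 0 < w (edge_src e) (edge_dst e).
Hypothesis r0 : forall l : 'I_n.+2, (0 < l < n.+1)%N -> 0 < r l.
Variables mu0 muT : probability (measurableTypeR R) R.
Variable P : probability (times R n) R.
Hypothesis plan : transport_plan tf mu0 muT r P.
Hypothesis optP : (total_cost w P <= energy w (quantile_map P))%E.
Hypothesis finP : (total_cost w P < +oo)%E.

Let X (l : 'I_n.+2) : times R n -> measurableTypeR R := time l.
Let F l := dist_fun P (X l).
Let mX l : measurable_fun setT (X l) := measurable_time l.
Let cF l : is_cdf tf (F l) := is_cdf_marginal plan l.

Let i1 : 'I_n.+2 := lift ord0 ord0.
(** The assumption [1 <= n] makes node 1 an intermediate node, where the density bound applies. *)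
Let i1_mid : (0 < i1 < n.+1)%N.
Proof. by rewrite /= /bump/= ltnS. Qed.

(* Node 1 has an atomless marginal, so that V is uniform on [0, 1]. *)
Let V (t : times R n) : measurableTypeR R := F i1 (X i1 t).

Let mV : measurable_fun setT V.
Proof. exact: (measurableT_comp (measurable_dist_fun (cF i1)) (mX i1)). Qed.

Let FQ (l : 'I_n.+2) c : (0 < l < n.+1)%N -> 0 < c <= 1 -> F l (quantile (F l) c) = c.
Proof.
move=> hl c01; apply: (dist_fun_quantileK tf0 (cF l) (r0 hl)) => // a b.
exact: (marginal_lipschitz r0 plan).
Qed.

(** Level 0 is attained at -1, to the left of all the mass, and a positive level at its quantile. *)
Let F_onto (l : 'I_n.+2) c : (0 < l < n.+1)%N -> 0 <= c <= 1 -> exists y, F l y = c.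
Proof.
move=> hl /andP[]; rewrite le_eqVlt => /predU1P[<- _|c0 c1].
  by exists (-1); have [_ F0 _ _] := cF l; rewrite F0// ltrN10.
by exists (quantile (F l) c); rewrite FQ// c0.
Qed.

(** The coordinate at node 1 has the law of its quantile function under [unif], and [F i1] inverts
    that function on ]0, 1]. *)
Let law_V B : measurable B -> P (V @^-1` B) = unif B.
Proof.
move=> mB.
have mFB : measurable (F i1 @^-1` B : set (measurableTypeR R)).
  by rewrite -[X in measurable X]setTI; exact: (measurable_dist_fun (cF i1)).
rewrite -[LHS](law_quantile tf0 (mX i1) (cF i1) mFB).
apply: unif_eq => //.
  by rewrite -[X in measurable X]setTI; exact: (measurable_quantile tf0 (cF i1)).
by move=> u u01; rewrite /preimage/= FQ.
Qed.

(** Monotonicity of [F i1] gives one inclusion; both events have mass [F i1 z] because [V] is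
    uniform. *)
Let V_le_base z : {ae P, forall t, (X i1 t <= z) = (V t <= F i1 z)}.
Proof.
have [ndF _ _ _] := cF i1.
have H : {ae P, forall t, [set t | X i1 t <= z] t <-> [set t | V t <= F i1 z] t}.
  apply: ae_eq_subset.
  - exact: measurable_le_fun.
  - exact: measurable_le_fun.
  - by move=> t /= tz; exact: ndF.
  - rewrite -(dist_funE _ (mX i1)).
    have -> : [set t | V t <= F i1 z] = V @^-1` `]-oo, F i1 z]%classic.
      by apply/seteqP; split => t /=; rewrite in_itv.
    by rewrite law_V// unif_Nitv// (is_cdf_ge0 _ (cF i1)) (is_cdf_le1 _ (cF i1)).
by apply: filterS H => t /= [h1 h2]; apply/idP/idP.
Qed.

Let edge_le (e : 'I_n.+1) y z : F (edge_src e) y = F (edge_dst e) z ->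
  {ae P, forall t, (X (edge_src e) t <= y) = (X (edge_dst e) t <= z)}.
Proof.
move=> yz; have [fine_e opt_e] := optimal_edge tf0 w0 r0 plan optP finP e.
exact: (optimal_le_eq (mX _) (mX _) tf0 (cF _) (cF _) fine_e opt_e).
Qed.

(** The description of level sets spreads from node 1 along the edges: [edge_le] needs equal levels
    at both ends, and an intermediate node attains every level in [0, 1]. *)
Let V_le (l : 'I_n.+2) z : {ae P, forall t, (X l t <= z) = (V t <= F l z)}.
Proof.
case: l z => l ln z.
elim: l ln z => [|l IH] ln z.
  (* The first edge is traversed backwards, from node 1 to node 0: [mu0] may have atoms, so the
     induction cannot start at node 0. *)
  have F01 : 0 <= F ord0 z <= 1.
    by rewrite (is_cdf_ge0 _ (cF _)) (is_cdf_le1 _ (cF _)).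
  have [y yz] := F_onto i1_mid F01.
  have src0 : edge_src ord0 = Ordinal ln :> 'I_n.+2 by exact/val_inj.
  have ord0E : ord0 = Ordinal ln :> 'I_n.+2 by exact/val_inj.
  have := @edge_le ord0 z y; rewrite src0 -ord0E -[edge_dst ord0]/i1 yz => /(_ erefl) h.
  by apply: filterS2 h (V_le_base y) => t -> ->; rewrite yz.
have [l0|l0] := posnP l.
  have -> : Ordinal ln = i1 by apply/val_inj; rewrite /= l0.
  exact: V_le_base.
have ln1 : (l < n.+1)%N by [].
have ln2 : (l < n.+2)%N by exact: ltnW.
have hl : (0 < Ordinal ln2 < n.+1)%N by rewrite /= l0.
have F01 : 0 <= F (Ordinal ln) z <= 1.
  by rewrite (is_cdf_ge0 _ (cF _)) (is_cdf_le1 _ (cF _)).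
have [y yz] := F_onto hl F01.
have srcE : edge_src (Ordinal ln1) = Ordinal ln2 :> 'I_n.+2 by exact/val_inj.
have dstE : edge_dst (Ordinal ln1) = Ordinal ln :> 'I_n.+2 by exact/val_inj.
have := @edge_le (Ordinal ln1) y z; rewrite srcE dstE yz => /(_ erefl) h.
by apply: filterS2 h (IH ln2 y) => t <- ->; rewrite yz.
Qed.

Let X_quantile : {ae P, forall t, t = quantile_map P (V t)}.
Proof.
have V01 : {ae P, forall t, 0 < V t <= 1}.
  exists (V @^-1` ~` `]0, 1]%classic); split.
  - by rewrite -[X in measurable X]setTI; apply: mV => //; exact: measurableC.
  - rewrite law_V; last exact: measurableC.
    by rewrite probability_setC// unif_itv// subr0 subee.
  - by move=> t /= /negP; rewrite in_itv/= => /negP.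
(* Countably many null sets can be discarded together, so thresholds are restricted to rationals,
   enumerated by [unpickle]; codes of no rational default to 0. *)
have H : {ae P, forall t, forall (k : nat) (l : 'I_n.+2),
    let z := ratr (odflt 0 (unpickle k : option rat)) in
    (X l t <= z) = (V t <= F l z)}.
  apply: ae_foralln => k; apply: filter_forall => l; exact: V_le.
apply: filterS2 V01 H => t Vt tH.
apply: eq_from_tnth => l; rewrite -/(time l t) -/(time l (quantile_map P (V t))).
rewrite time_quantile_map -/(F l).
have rat_le (q : rat) : (time l t <= ratr q) = (quantile (F l) (V t) <= ratr q).
  by have := tH (pickle q) l; rewrite /= pickleK/= (quantile_le _ tf0 (cF l) Vt).
apply/eqP; rewrite eq_le; apply/andP; split; rewrite leNgt; apply/negP => /rat_in_itvoo[q];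
  rewrite in_itv/= => /andP[h1 h2].
- by have := ltW h1; rewrite -rat_le leNgt h2.
- by have := ltW h1; rewrite rat_le leNgt h2.
Qed.

Lemma optimal_plan_law A : measurable A -> P A = unif (quantile_map P @^-1` A).
Proof.
move=> mA.
have mQ : measurable_fun setT (quantile_map P).
  exact: admissible_measurable (admissible_quantile_map tf0 r0 plan).
have mQA : measurable (quantile_map P @^-1` A).
  by rewrite -[X in measurable X]setTI; exact: mQ.
rewrite -law_V//; apply: ae_eq_measure => //.
  by rewrite -[X in measurable X]setTI; exact: mV.
by apply: filterS X_quantile => t tE; rewrite /preimage/= -tE.
Qed.

End rigidity.

Section as_probability.
Context d (T : measurableType d) (R : realType) (mu : {measure set T -> \bar R}).

(* The unused argument carries the mass of [mu] to the instances below. *)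
Definition as_probability (_ : mu setT = 1%E) : set T -> \bar R := mu.

Variable mu1 : mu setT = 1%E.

HB.instance Definition _ := isMeasure.Build _ _ _ (as_probability mu1)
  (measure0 mu) (measure_ge0 mu) (@measure_semi_sigma_additive _ _ _ mu).

HB.instance Definition _ :=
  Measure_isProbability.Build _ _ _ (as_probability mu1) mu1.

End as_probability.

(** * Existence and uniqueness of the optimal plan *)

Theorem theorem2 (R : realType) (tf : R) (n : nat)
    (w : 'I_n.+2 -> 'I_n.+2 -> R)
    (mu0 muT : probability (measurableTypeR R) R) (r : 'I_n.+2 -> R) :
  0 < tf ->
  (1 <= n)%N ->
  (forall e : 'I_n.+1, 0 < w (edge_src e) (edge_dst e)) ->
  mu0 `[0, tf]%classic = 1%E ->
  muT `[0, tf]%classic = 1%E ->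
  (forall l : 'I_n.+2, (0 < l < n.+1)%N -> 0 < r l) ->
  feasible tf w mu0 muT r ->
  exists2 pi : {measure set (times R n) -> \bar R},
    minimizer tf w mu0 muT r pi &
    forall pi' : {measure set (times R n) -> \bar R},
      minimizer tf w mu0 muT r pi' ->
      forall A : set (times R n), measurable A -> pi' A = pi A.
Proof.
move=> tf0 n1 w0 mu01 muT1 r0 [pi0 plan0 fin0].
pose prob (pi : {measure set (times R n) -> \bar R})
    (plan : transport_plan tf mu0 muT r pi) : probability (times R n) R :=
  as_probability (transport_plan_setT plan).
have plan_prob pi plan : transport_plan tf mu0 muT r (prob pi plan) by exact: plan.
pose adm := admissible tf r (marginal_quantile mu0) (marginal_quantile muT) (n := n).
have adm_prob pi plan : adm (quantile_map (prob pi plan)).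
  exact: admissible_quantile_map.
have energy_prob pi plan : (energy w (quantile_map (prob pi plan)) <= total_cost w pi)%E.
  exact: (energy_quantile_map_le tf0 w0 r0 (plan_prob pi plan)).
have exadm : exists2 T, adm T & (energy w T < +oo)%E.
  exists (quantile_map (prob _ plan0)); first exact: adm_prob.
  exact: le_lt_trans (energy_prob _ _) fin0.
have mfin := minimal_fin_num w0 exadm.
have [T aT Tm] := minimal_exists tf0 w0 r0 exadm.
have mT := admissible_measurable aT.
have planT := transport_plan_image tf0 r0 mT mu01 muT1 aT.
have costT := total_cost_image w0 mT.
have T_le S : adm S -> (energy w T <= energy w S)%E.
  by move=> aS; rewrite Tm; apply: ereal_inf_lbound; exists S.
(* No plan costs less than its own quantile curve, and no admissible curve costs less than [T]. *)
exists (image_plan mT).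
  split => // pi' plan'; rewrite costT.
  by apply: le_trans (energy_prob _ plan'); exact: T_le.
move=> pi' [plan' min'] A mA.
have cost' : (total_cost w pi' <= energy w T)%E by rewrite -costT; exact: min'.
have opt' : (total_cost w pi' <= energy w (quantile_map (prob _ plan')))%E.
  by apply: le_trans cost' _; exact: T_le.
have fin' : (total_cost w pi' < +oo)%E.
  by apply: le_lt_trans cost' _; rewrite Tm -ge0_fin_numE// -Tm energy_ge0.
(* The quantile curve of another minimizer also has least energy, hence equals [T] almost
   everywhere, and both plans are images of [unif] under these curves. *)
have Qm : energy w (quantile_map (prob _ plan')) = energy w T.
  apply/eqP; rewrite eq_le T_le// andbT.
  exact: le_trans (energy_prob _ plan') cost'.
have QT := minimal_unique tf0 w0 (adm_prob _ plan') aT mfin (etrans Qm Tm) Tm.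
transitivity (unif (quantile_map (prob _ plan') @^-1` A)).
  exact: (optimal_plan_law tf0 n1 w0 r0 (plan_prob _ plan') opt' fin' mA).
have mQ := admissible_measurable (adm_prob _ plan').
apply: ae_eq_measure.
- by rewrite -[X in measurable X]setTI; exact: (mQ measurableT _ mA).
- by rewrite -[X in measurable X]setTI; exact: (mT measurableT _ mA).
by apply: (@filterS _ _ (ae_filter_ringOfSetsType unif)) QT => u uE; rewrite /preimage/= uE.
Qed.
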